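(* Let $X$ be a Riemann surface and let $\varphi_0\in A^2(X)$ be an (integrable) holomorphic quadratic differential on $X$. (1) If two Beltrami differentials $\mu,\nu\in L^\infty(X)$ are infinitesimally Teichmüller equivalent, then $\beta(\mu,\varphi_0)=\beta(\nu,\varphi_0)$. (2) For a Beltrami differential $\mu\in L^\infty(X)$, the following three conditions are equivalent: (a) $\mu$ is infinitesimally $\varphi_0$-extremal; (b) $\mu$ is infinitesimally Teichmüller extremal; (c) $\mu$ satisfies the Hamilton condition.
   Context: $L^\infty(X)$ is the complex Banach space of bounded measurable $(-1,1)$-forms $\mu=\mu(z)\,d\overline z/dz$ on $X$ (Beltrami differentials) with the essential supremum norm $\|\mu\|_\infty$. $A^2(X)$ is the Banach space of holomorphic quadratic differentials $\varphi=\varphi(z)dz^2$ on $X$ with $\|\varphi\|_1=\int_X|\varphi(z)|\,dxdy<\infty$. The pairing of $\mu\in L^\infty(X)$ and $\varphi\in A^2(X)$ is $\int_X\mu\varphi=\int_X\mu(z)\varphi(z)\,dxdy$. Set $N^\infty(X)=\{\mu\in L^\infty(X):\int_X\mu\varphi=0\ \text{for all }\varphi\in A^2(X)\}$. Two Beltrami differentials $\mu,\nu$ are infinitesimally Teichmüller equivalent if $\mu-\nu\in N^\infty(X)$. For $\mu\in L^\infty(X)$ and $\varphi_0\in A^2(X)$ define $$\beta(\mu,\varphi_0)=\sup\left\{\left|\int_X\mu\varphi\right|+\mathrm{Re}\int_X\mu\varphi_0 \;:\; \varphi\in A^2(X),\ \|\varphi\|_1=1\right\}.$$ $\mu$ is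 infinitesimally $\varphi_0$-extremal if $\beta(\mu,\varphi_0)=\|\mu\|_\infty+\mathrm{Re}\int_X\mu\varphi_0$. $\mu$ is infinitesimally Teichmüller extremal if $\|\mu-\nu\|_\infty\ge\|\mu\|_\infty$ for all $\nu\in N^\infty(X)$. $\mu$ satisfies the Hamilton condition if $\sup\{|\int_X\mu\varphi| : \varphi\in A^2(X),\ \|\varphi\|_1\le1\}=\|\mu\|_\infty$. *)

(* Defs.v *)
From HB Require Import structures.
From mathcomp Require Import all_boot all_order all_algebra.
From mathcomp Require Import complex.
From mathcomp Require Import all_classical all_reals all_analysis.
From mathcomp Require Import ess_sup_inf.

Set Implicit Arguments.
Unset Strict Implicit.
Unset Printing Implicit Defensive.

Import Order.TTheory GRing.Theory Num.Theory.
Import numFieldNormedType.Exports.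

Local Open Scope classical_set_scope.
Local Open Scope ring_scope.

(* The regular algebra R[i]^o, rather than R[i], carries the norm topology. *)
Notation Cplx R := (R[i]%type^o).

(* A connected second countable Hausdorff space with a holomorphic atlas, which
   need not be maximal: [chart i] is a homeomorphism from the open set [dom i]
   onto the open set [img i] of the plane, with inverse [unchart i].  Values of
   [chart i] off [dom i] and of [unchart i] off [img i] are irrelevant. *)
Record riemannSurface (R : realType) := RiemannSurface {
  carrier :> topologicalType ;
  carrier_nonempty : [set: carrier] !=set0 ;
  carrier_hausdorff : hausdorff_space carrier ;
  carrier_connected : connected [set: carrier] ;
  carrier_countable : @second_countable carrier ;
  chart_index : Type ;
  dom : chart_index -> set carrier ;
  img : chart_index -> set (Cplx R) ;
  chart : chart_index -> carrier -> Cplx R ;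
  unchart : chart_index -> Cplx R -> carrier ;
  dom_open : forall i, open (dom i) ;
  img_open : forall i, open (img i) ;
  chart_img : forall i x, dom i x -> img i (chart i x) ;
  unchart_dom : forall i z, img i z -> dom i (unchart i z) ;
  chartK : forall i x, dom i x -> unchart i (chart i x) = x ;
  unchartK : forall i z, img i z -> chart i (unchart i z) = z ;
  chart_continuous : forall i, {within dom i, continuous (chart i)} ;
  unchart_continuous : forall i, {within img i, continuous (unchart i)} ;
  dom_cover : forall x, exists i, dom i x ;
  transition_holomorphic : forall i j x, dom i x -> dom j x ->
    derivable (chart j \o unchart i : Cplx R -> Cplx R) (chart i x) 1
}.

Lemma countable_subcover (R : realType) (X : riemannSurface R) :
  exists u : nat -> chart_index X, forall x, exists n, dom (u n) x.
Proof.
have [x0 _] := @carrier_nonempty _ X; have [i0 _] := dom_cover x0.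
have [B /pfcard_geP cB [Bo Bb]] := @carrier_countable _ X.
have nbhsB x i : dom i x -> exists V, [/\ B V, V x & V `<=` dom i].
  move=> ix; have : nbhs x (dom i).
    by apply: open_nbhs_nbhs; split; first exact: dom_open.
  by move/Bb => [V [BV Vx] Vi]; exists V.
case: cB => [B0|[f]].
  have [i ix0] := dom_cover x0; have [V [BV _ _]] := nbhsB _ _ ix0.
  by rewrite B0 in BV.
have /boolp.choice[u uP] : forall n, exists i : chart_index X,
    (exists j, f n `<=` dom j) -> f n `<=` dom i.
  move=> n; have [[i fi]|nfi] := pselect (exists i, f n `<=` dom i); first by exists i.
  by exists i0 => /nfi.
exists u => x; have [i ix] := dom_cover x; have [V [BV Vx Vi]] := nbhsB _ _ ix.
have [n _ fnV] : (f @` [set: nat]) V by exact: surj.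
by exists n; apply: uP; [exists i; rewrite fnV | rewrite fnV].
Qed.

Section forms.
Context (R : realType) (X : riemannSurface R).

Definition transition (i j : chart_index X) : Cplx R -> Cplx R :=
  chart j \o unchart i.

(* A differential is given by its coefficient in every chart; the coefficient
   [f i] is relevant on [img i] only. *)
Definition coefficients := chart_index X -> Cplx R -> Cplx R.

Definition beltrami_form (mu : coefficients) :=
  forall i j x, dom i x -> dom j x ->
    let z := chart i x in let dT := derive1 (transition i j) z in
    mu j (transition i j z) * (dT^*)%C / dT = mu i z.

Definition quadratic_form (phi : coefficients) :=
  forall i j x, dom i x -> dom j x ->
    let z := chart i x in let dT := derive1 (transition i j) z in
    phi j (transition i j z) * dT ^+ 2 = phi i z.

Definition toC (p : R * R) : Cplx R := (p.1 +i* p.2)%C.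

Local Notation area := (@lebesgue_measure R \x @lebesgue_measure R)%E.

Definition essnorm (mu : coefficients) : \bar R :=
  ereal_sup (range (fun i => ess_sup area
    ((fun p => (Normc.normc (mu i (toC p)))%:E) \_ (toC @^-1` img i)))).

Definition supnorm (mu : coefficients) : R := fine (essnorm mu).

(* Coefficients are Borel measurable, and forms that agree almost everywhere are
   not identified: the norm and the integrals below do not distinguish them. *)
Definition Linfty : set coefficients := [set mu |
  [/\ beltrami_form mu,
      forall i, measurable_fun (toC @^-1` img i)
        (fun p => complex.Re (mu i (toC p))),
      forall i, measurable_fun (toC @^-1` img i)
        (fun p => complex.Im (mu i (toC p)))
    & (essnorm mu < +oo)%E]].

(* X is the disjoint union of the sets dom (u n) `\` \bigcup_(m < n) dom (u m),
   for a sequence of charts u whose domains cover X; a form of type (1,1) is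
   integrated piece by piece.  By the change of variables formula the integral
   does not depend on u. *)
Definition charts : nat -> chart_index X := projT1 (cid (countable_subcover X)).

Definition piece (n : nat) : set (R * R) :=
  toC @^-1` (chart (charts n) @`
    (dom (charts n) `\` \bigcup_(m in [set m | (m < n)%N]) dom (charts m))).

Definition surface_integral (f : chart_index X -> Cplx R -> R) : \bar R :=
  (\sum_(0 <= n <oo) \int[area]_(p in piece n) (f (charts n) (toC p))%:E)%E.

Definition norm1 (phi : coefficients) : \bar R :=
  surface_integral (fun i z => Normc.normc (phi i z)).

Definition A2 : set coefficients := [set phi |
  [/\ quadratic_form phi,
      forall i z, img i z -> derivable (phi i) z 1
    & (norm1 phi < +oo)%E]].

Definition pairing (mu phi : coefficients) : R[i] :=
  (fine (surface_integral (fun i z => complex.Re (mu i z * phi i z))) +i*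
   fine (surface_integral (fun i z => complex.Im (mu i z * phi i z))))%C.

Definition Ninfty : set coefficients :=
  [set mu | Linfty mu /\ forall phi, A2 phi -> pairing mu phi = 0].

Definition inf_teichmuller_equivalent (mu nu : coefficients) :=
  Ninfty (mu - nu).

(* If A2 X = 0 the index set is empty and the supremum is 0 by convention
   ([sup set0 = 0]), as befits a supremum of norms. *)
Definition beta (mu phi0 : coefficients) : R :=
  sup [set Normc.normc (pairing mu phi) + complex.Re (pairing mu phi0) |
        phi in [set phi | A2 phi /\ norm1 phi = 1%E]].

Definition inf_extremal (phi0 mu : coefficients) :=
  beta mu phi0 = supnorm mu + complex.Re (pairing mu phi0).

Definition inf_teichmuller_extremal (mu : coefficients) :=
  forall nu, Ninfty nu -> supnorm mu <= supnorm (mu - nu).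

Definition hamilton (mu : coefficients) :=
  sup [set Normc.normc (pairing mu phi) |
        phi in [set phi | A2 phi /\ (norm1 phi <= 1)%E]] = supnorm mu.

End forms.

(* Main.v *)
(* [|pairing mu phi|] is at most [supnorm mu * norm1 phi], so the norm of [mu] as
   a functional on [A2], which only depends on the equivalence class of [mu], is
   a lower bound for the norm of every form in the class: hence the Hamilton
   condition implies extremality.  Conversely, the functional extends to L^1 of
   the surface with the same norm by the Hahn-Banach theorem, and the extension
   is represented by a form in L^infinity (Radon-Nikodym), which is equivalent
   to [mu] and has the norm of the functional.  Finally, [beta mu phi0] is the
   norm of the functional plus [Re (pairing mu phi0)]. *)

From HB Require Import structures.
Require Import Defs.
From mathcomp Require Import finmap.
From mathcomp Require Import all_boot all_order all_algebra.
From mathcomp Require Import complex.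
From mathcomp Require Import all_classical all_reals all_analysis.
From mathcomp Require Import measurable_realfun ess_sup_inf.
From mathcomp Require Import ring lra.

Set Implicit Arguments.
Unset Strict Implicit.
Unset Printing Implicit Defensive.

Import Order.TTheory GRing.Theory Num.Theory.
Import numFieldNormedType.Exports.

Local Open Scope classical_set_scope.
Local Open Scope ring_scope.

(** * The Hahn-Banach theorem *)

(** Three mismatches shape the proof. Pairings are complex, while Hahn-Banach is applied over the
    reals, to real parts; since [A2] is stable under multiplication by the imaginary unit, real
    parts determine pairings. The extension then has two real densities, each bounded by C, which
    alone bounds the complex density only by sqrt 2 times C. The exact constant has to be recovered,
    since it is compared with [supnorm mu] itself.

    Next, integrals see only the disjoint pieces, whereas [essnorm] is a supremum over all charts. A
    density found on the pieces must become a coefficient in every chart without raising its bound.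
    This is why densities are truncated until their bounds hold at every point, before they are
    transported.

    Last, [beta] runs over the unit sphere of [A2] and [hamilton] over the unit ball. Scaling
    identifies the two suprema unless the sphere is empty; then every form has norm 0, all pairings
    vanish, and the value 0 of the empty supremum is the right one. *)

Section hahn_banach.
Context (R : realType) (V : lmodType R).
Implicit Types (D W : set V) (p l : V -> R) (G : set (V * R)).

Definition subspace_set D :=
  D 0 /\ forall (c : R) x y, D x -> D y -> D (c *: x + y).

Definition linear_on D l :=
  forall (c : R) x y, D x -> D y -> l (c *: x + y) = c * l x + l y.

(* Partial linear functionals dominated by [p] are encoded by their graphs,
   which are automatically single-valued (see [linear_graph_fun]). *)
Definition linear_graph D p G := forall x a, G (x, a) ->
  [/\ D x, a <= p x & forall c y b, G (y, b) -> G (c *: x + y, c * a + b)].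

Variables (D : set V) (p : V -> R).
Hypothesis D_sub : subspace_set D.
Hypothesis p_homo : forall c x, 0 < c -> D x -> p (c *: x) = c * p x.
Hypothesis p_subadd : forall x y, D x -> D y -> p (x + y) <= p x + p y.

Lemma subspace_setZ E c x : subspace_set E -> E x -> E (c *: x).
Proof. by move=> [E0 EL] Ex; rewrite -[_ *: _]addr0; exact: EL. Qed.

Lemma subspace_setD E x y : subspace_set E -> E x -> E y -> E (x + y).
Proof. by move=> [E0 EL] Ex Ey; rewrite -[x]scale1r; exact: EL. Qed.

Lemma linear_graphZ G c x a : G (0, 0) -> linear_graph D p G ->
  G (x, a) -> G (c *: x, c * a).
Proof. by move=> G0 lG /lG[_ _ /(_ c _ _ G0)]; rewrite !addr0. Qed.

Lemma linear_graphD G x a y b : linear_graph D p G ->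
  G (x, a) -> G (y, b) -> G (x + y, a + b).
Proof. by move=> lG /lG[_ _ H] /(H 1); rewrite scale1r mul1r. Qed.

(** The difference of two values at [x] is a value at 0, hence at most [p 0]; and [p 0 = 0] because
    homogeneity gives [p 0 = 2 * p 0]. *)
Lemma linear_graph_fun G x a b : G (0, 0) -> linear_graph D p G ->
  G (x, a) -> G (x, b) -> a = b.
Proof.
move=> G0 lG.
have p0 : p 0 = 0.
  have := p_homo (x := 0) (ltr0n R 2) (proj1 D_sub); rewrite scaler0; lra.
suff le a' b' : G (x, a') -> G (x, b') -> a' <= b'.
  by move=> Ga Gb; apply/eqP; rewrite eq_le !le.
move=> Ga Gb; have [_ _ /(_ (-1) _ _ Ga)] := lG _ _ Gb.
rewrite scaleN1r addNr => /lG[_ + _]; rewrite p0; lra.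
Qed.

(** A value at [x0] is admissible when it lies above all [a - p (z - x0)] and below all
    [p (y + x0) - b]. Subadditivity puts the first family below the second, and its supremum is
    taken. Dividing by the absolute value of [t] reduces domination at [y + t *: x0] to these two
    inequalities, one for each sign of [t]. *)
Lemma linear_graph_extend G x0 : G (0, 0) -> linear_graph D p G -> D x0 ->
  exists2 G', linear_graph D p G' & G `<=` G' /\ exists a, G' (x0, a).
Proof.
move=> G0 lG Dx0.
pose S := [set ya.2 - p (ya.1 - x0) | ya in G].
have ubS y b : G (y, b) -> ubound S (p (y + x0) - b).
  move=> Gyb _ [[z a] Gza <-] /=.
  have [Dy _ _] := lG _ _ Gyb; have [Dz _ _] := lG _ _ Gza.
  have [_ le _] := lG _ _ (linear_graphD lG Gza Gyb).
  have DN : D (z - x0).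
    by rewrite -scaleN1r addrC; case: D_sub => _; exact.
  have := p_subadd DN (subspace_setD D_sub Dy Dx0).
  rewrite addrACA [- x0 + x0]addNr addr0; lra.
have S0 : S !=set0 by exists (0 - p (0 - x0)); exists (0, 0).
have supS y b : G (y, b) -> b - p (y - x0) <= sup S.
  move=> Gyb; apply: ub_le_sup; last by exists (y, b).
  by exists (p (0 + x0) - 0); exact: ubS.
have infS y b : G (y, b) -> sup S <= p (y + x0) - b.
  by move=> Gyb; apply: sup_le_ub => //; exact: ubS.
pose al := sup S.
pose G' : set (V * R) :=
  [set xa | exists t y b, G (y, b) /\ xa = (y + t *: x0, b + t * al)].
exists G'; last first.
  split; last by exists al, 1, 0, 0; rewrite scale1r mul1r !add0r.
  by move=> [y b] Gyb; exists 0, y, b; rewrite scale0r mul0r !addr0.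
move=> _ _ [t [y [b [Gyb [-> ->]]]]]; have [Dy le _] := lG _ _ Gyb; split.
- by apply: (subspace_setD D_sub) => //; exact: subspace_setZ.
- have [->|t0] := eqVneq t 0; first by rewrite scale0r mul0r !addr0.
  have tV c : c != 0 -> c^-1 *: (y + t *: x0) = c^-1 *: y + (t / c) *: x0.
    by move=> c0; rewrite scalerDr scalerA mulrC.
  have GtV c := linear_graphZ c^-1 G0 lG Gyb.
  have Dt : D (y + t *: x0).
    by apply: (subspace_setD D_sub) => //; exact: subspace_setZ.
  have [tlt|tgt] := ltP t 0.
  + have mt : 0 < - t by lra.
    have mt0 : - t != 0 by rewrite oppr_eq0.
    have := supS _ _ (GtV (- t)).
    have -> : (- t)^-1 *: y - x0 = (- t)^-1 *: (y + t *: x0).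
      by rewrite tV// invrN mulrN divff// scaleN1r.
    rewrite p_homo ?invr_gt0// -mulrBr -(ler_pM2l mt) mulrA divff// mul1r.
    by rewrite -/al; lra.
  + have pt : 0 < t by rewrite lt_neqAle eq_sym t0.
    have := infS _ _ (GtV t).
    have -> : t^-1 *: y + x0 = t^-1 *: (y + t *: x0).
      by rewrite tV// divff// scale1r.
    rewrite p_homo ?invr_gt0// -mulrBr -(ler_pM2l pt) mulrA divff// mul1r.
    by rewrite -/al; lra.
- move=> c _ _ [u [z [a [Gza [-> ->]]]]].
  exists (c * t + u), (c *: y + z), (c * b + a); split.
    by have [_ _] := lG _ _ Gyb; exact.
  by rewrite scalerDr !scalerDl scalerA addrACA; congr pair; ring.
Qed.

(** Zorn's lemma gives a maximal dominated graph; a point of [D] outside its domain could be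
    adjoined by [linear_graph_extend]. *)
Theorem hahn_banach W l : subspace_set W -> W `<=` D -> linear_on W l ->
  (forall x, W x -> l x <= p x) ->
  exists L, [/\ linear_on D L, forall x, W x -> L x = l x &
    forall x, D x -> L x <= p x].
Proof.
move=> [W0 WL] WD ll lp.
pose G0 : set (V * R) := [set xa | W xa.1 /\ xa.2 = l xa.1].
have l0 : l 0 = 0 by have := ll 1 _ _ W0 W0; rewrite scale1r addr0; lra.
have G00 : G0 (0, 0) by [].
have lG0 : linear_graph D p G0.
  move=> x a [/= Wx ->]; split; [exact: WD|exact: lp|].
  by move=> c y b [/= Wy ->]; split => /=; [exact: WL|rewrite ll].
(* Adjoining [G0] makes [P] hold for the union of the empty chain. *)
pose P A := linear_graph D p (A `|` G0).
have [|A [PA Amax]] := @Zorn_bigcup _ P.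
  move=> F FP Ftot x a.
  pose U := \bigcup_(X in F) X `|` G0.
  (* Linearity involves two elements at a time, and any two elements of the union of a chain already
     lie in one dominated graph. *)
  have common y b z d : U (y, b) -> U (z, d) -> exists2 X, linear_graph D p X &
      [/\ X (y, b), X (z, d) & X `<=` U].
    have sub X : F X -> X `|` G0 `<=` U.
      by move=> FX q [Xq|]; [left; exists X|right].
    move=> [[X FX Xy]|Gy] [[Y FY Yz]|Gz].
    - have [XY|YX] := Ftot _ _ FX FY.
      + exists (Y `|` G0); first exact: FP.
        by split; [left; exact: XY|left|exact: sub].
      + exists (X `|` G0); first exact: FP.
        by split; [left|left; exact: YX|exact: sub].
    - by exists (X `|` G0); [exact: FP|split; [left|right|exact: sub]].
    - by exists (Y `|` G0); [exact: FP|split; [right|left|exact: sub]].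
    - by exists G0 => //; split => // q; right.
  move=> Ux; split; [| |move=> c y b Uy].
  - by have [X lX [Xx _ _]] := common _ _ _ _ Ux Ux; have [] := lX _ _ Xx.
  - by have [X lX [Xx _ _]] := common _ _ _ _ Ux Ux; have [] := lX _ _ Xx.
  - have [X lX [Xx Xy XU]] := common _ _ _ _ Ux Uy; apply: XU.
    by have [_ _] := lX _ _ Xx; exact.
set M := A `|` G0 in PA.
have M0 : M (0, 0) by right.
have domM x : D x -> exists a, M (x, a).
  move=> Dx; have [G' lG' [MG' [a G'a]]] := linear_graph_extend M0 PA Dx.
  apply: contrapT => nM; apply: (Amax G'); last first.
    rewrite /P; suff -> : G' `|` G0 = G' by [].
    by apply/seteqP; split => [q [//|G0q]|q]; [apply: MG'; right|left].
  split; first by move=> q Aq; apply: MG'; left.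
  by move=> G'A; apply: nM; exists a; left; exact: G'A.
pose L x := xget 0 [set a | M (x, a)].
have ML x : D x -> M (x, L x).
  move=> /domM[a Ma].
  exact: (@xgetPex _ 0 [set a | M (x, a)] (ex_intro _ a Ma)).
exists L; split.
- move=> c x y Dx Dy; apply: (linear_graph_fun M0 PA).
    by apply: ML; case: D_sub => _; exact.
  by have [_ _] := PA _ _ (ML _ Dx); apply; exact: ML.
- move=> x Wx; apply: (linear_graph_fun M0 PA); first exact/ML/WD.
  by right.
- by move=> x Dx; have [] := PA _ _ (ML _ Dx).
Qed.

End hahn_banach.

(** * The dual of L^1 over a sigma-finite measure *)

Section bounded_functionals.
Context d (T : measurableType d) (R : realType).
Variable mu : {sigma_finite_measure set T -> \bar R}.
Implicit Types (f g : T -> R) (Phi : (T -> R) -> R).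

Definition L1 f := mu.-integrable setT (EFin \o f).

Lemma L1_measurable f : L1 f -> measurable_fun setT f.
Proof. by move=> /measurable_int/measurable_EFinP. Qed.

Lemma le_L1 f g : measurable_fun setT f -> (forall x, `|f x| <= `|g x|) ->
  L1 g -> L1 f.
Proof.
move=> mf fg; apply: le_integrable => //; first exact/measurable_EFinP.
by move=> x _; rewrite /= lee_fin.
Qed.

Lemma L1_linear c f g : L1 f -> L1 g -> L1 (fun x => c * f x + g x).
Proof.
move=> fi gi.
exact: (integrableD measurableT (integrableZl measurableT c fi) gi).
Qed.

Lemma L1Z c f : L1 f -> L1 (fun x => c * f x).
Proof. by move=> fi; exact: (integrableZl measurableT c fi). Qed.

Lemma L1_0 : L1 (cst 0).
Proof. exact: integrable0. Qed.

Lemma L1_norm f : L1 f -> L1 (fun x => `|f x|).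
Proof. exact: integrable_abse. Qed.

Lemma L1_indic A : measurable A -> (mu A < +oo)%E -> L1 (\1_A).
Proof.
move=> mA muA; apply/integrableP; split; first exact/measurable_EFinP.
under eq_integral do rewrite gee0_abs ?lee_fin//.
by rewrite integral_indic// setIT.
Qed.

Lemma L1_mul C g f : measurable_fun setT g -> (forall x, `|g x| <= C) ->
  L1 f -> L1 (fun x => g x * f x).
Proof.
move=> mg gC fi; apply: (@le_L1 _ (fun x => C * f x)).
- by apply: measurable_funM => //; exact: L1_measurable.
- move=> x; rewrite !normrM ler_wpM2r//; exact: le_trans (gC x) (ler_norm _).
- exact: L1Z.
Qed.

(** [Phi] acts on functions rather than on classes; the bound makes it blind to null sets. Its
    values outside L^1 are unconstrained. *)
Definition bounded_functional (C : R) Phi :=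
  (forall c f g, L1 f -> L1 g ->
     Phi (fun x => c * f x + g x) = c * Phi f + Phi g) /\
  (forall f, L1 f -> `|Phi f| <= C * \int[mu]_x `|f x|).

Lemma bounded_functional_mul (C : R) g : measurable_fun setT g ->
  (forall x, `|g x| <= C) ->
  bounded_functional C (fun f => \int[mu]_x (g x * f x)).
Proof.
move=> mg gC; split=> [c f h fi hi|f fi].
  rewrite -RintegralZl//; last exact: (@L1_mul C).
  rewrite -RintegralD//; last 2 first.
    - by apply: L1Z; exact: (@L1_mul C).
    - exact: (@L1_mul C).
  by apply: eq_Rintegral => x _; ring.
apply: le_trans (le_normr_Rintegral _ _) _ => //; first exact: (@L1_mul C).
rewrite -RintegralZl//; last exact: L1_norm.
apply: le_Rintegral => //.
- by apply: L1_norm; exact: (@L1_mul C).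
- by apply: L1Z; exact: L1_norm.
- by move=> x _; rewrite normrM ler_wpM2r.
Qed.

(** This compares a functional with integration against a candidate density: representation becomes
    the vanishing of a bounded functional. *)
Lemma bounded_functionalB C D Phi Psi : bounded_functional C Phi ->
  bounded_functional D Psi ->
  bounded_functional (C + D) (fun f => Phi f - Psi f).
Proof.
move=> [Pl Pb] [Sl Sb]; split=> [c f g fi gi|f fi].
  by rewrite Pl// Sl//; ring.
rewrite mulrDl; apply: le_trans (ler_normB _ _) _.
by apply: lerD; [exact: Pb|exact: Sb].
Qed.

Section functional.
Variables (C : R) (Phi : (T -> R) -> R).
Hypothesis bPhi : bounded_functional C Phi.

Lemma functional0 : Phi (cst 0) = 0.
Proof.
have [l _] := bPhi; have := l 1 _ _ L1_0 L1_0.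
have -> : (fun x => 1 * cst 0 x + cst 0 x) = cst 0 :> (T -> R).
  by apply/funext => x /=; rewrite mul1r addr0.
lra.
Qed.

Lemma functionalD f g : L1 f -> L1 g ->
  Phi (fun x => f x + g x) = Phi f + Phi g.
Proof.
have [l _] := bPhi => fi gi; rewrite -[Phi f]mul1r -l//.
by congr Phi; apply/funext => x /=; rewrite mul1r.
Qed.

Lemma functional_sum I (r : seq I) (c : I -> R) (f : I -> T -> R) :
  (forall i, L1 (f i)) ->
  L1 (fun x => \sum_(i <- r) c i * f i x) /\
  Phi (fun x => \sum_(i <- r) c i * f i x) = \sum_(i <- r) c i * Phi (f i).
Proof.
have [l _] := bPhi => fi; elim: r => [|i r [IH1 IH2]].
  rewrite (_ : (fun _ => _) = cst 0); last first.
    by apply/funext => x; rewrite big_nil.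
  by rewrite big_nil functional0; split => //; exact: L1_0.
rewrite (_ : (fun _ => _) = fun x => c i * f i x + \sum_(i <- r) c i * f i x).
  by rewrite big_cons l// IH2; split => //; exact: L1_linear.
by apply/funext => x; rewrite big_cons.
Qed.

(** Dominated convergence gives convergence in L^1, which the bound on [Phi] turns into convergence
    of values. *)
Lemma functional_cvg (f_ : (T -> R)^nat) f g :
  (forall n, measurable_fun setT (f_ n)) -> L1 g ->
  (forall n x, `|f_ n x| <= g x) -> (forall x, f_ ^~ x @ \oo --> f x) ->
  L1 f /\ Phi (f_ n) @[n --> \oo] --> Phi f.
Proof.
move=> mf_ gi fg ff.
have fi_ n : L1 (f_ n).
  by apply: (le_L1 (mf_ n) _ gi) => x; rewrite (le_trans (fg n x))// ler_norm.
have mf : measurable_fun setT f.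
  by apply: (measurable_fun_cvg mf_) => x _; exact: ff.
have ffE : {ae mu, forall x, setT x -> (f_ n x)%:E @[n --> \oo] --> (f x)%:E}.
  by apply: aeW => x _; apply: cvg_EFin; [exact: nearW|exact: ff].
have fgE : {ae mu, forall x n, setT x -> (`|(f_ n x)%:E| <= (g x)%:E)%E}.
  by apply: aeW => x n _; rewrite lee_fin.
have mfE n : measurable_fun setT (EFin \o f_ n) by exact/measurable_EFinP.
have mfE' : measurable_fun setT (EFin \o f) by exact/measurable_EFinP.
have [fi + _] := dominated_convergence measurableT mfE mfE' ffE gi fgE.
move=> /fine_cvgP[_ cvg0]; split => //.
have [l b] := bPhi.
apply/cvgrPdist_le => /= e e0.
(* The sign of [C] is unknown here, so this positive number above [C] serves as divisor. *)
have C0 : 0 < `|C| + 1 by rewrite ltr_wpDl.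
have /cvgrPdist_le /(_ (e / (`|C| + 1))) := cvg0.
rewrite divr_gt0// => /(_ isT); apply: filterS => n /=.
rewrite sub0r normrN.
have -> : fine (\int[mu]_x `|(f_ n x)%:E - (f x)%:E|) =
    \int[mu]_x `|f x - f_ n x|.
  by congr fine; apply: eq_integral => x _; rewrite -EFinB abse_EFin distrC.
move=> le; have -> : Phi f - Phi (f_ n) = Phi (fun x => f x - f_ n x).
  rewrite addrC -mulN1r -l//; congr Phi; apply/funext => x; ring.
apply: le_trans (b _ _) _.
  by rewrite (_ : (fun _ => _) = fun x => (-1) * f_ n x + f x);
    [exact: L1_linear|apply/funext => x; ring].
have I0 : 0 <= \int[mu]_x `|f x - f_ n x| by exact: Rintegral_ge0.
move: le; rewrite (ger0_norm I0) ler_pdivlMr// mulrC.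
apply: le_trans; rewrite ler_wpM2r//.
by rewrite (le_trans (ler_norm _))// lerDl.
Qed.

End functional.
End bounded_functionals.

(** * Bounded functionals on indicators: countable additivity and uniqueness *)

Section countable_additivity.
Import HBNNSimple.
Context d (T : measurableType d) (R : realType).
Variable mu : {sigma_finite_measure set T -> \bar R}.
Implicit Types (f g : T -> R) (Phi : (T -> R) -> R).

Lemma sum_indic_disjoint (E : (set T)^nat) n x : trivIset setT E ->
  \sum_(0 <= i < n) 1 * \1_(E i) x = \1_(\bigcup_(i in `I_n) E i) x :> R.
Proof.
move=> tE; elim: n => [|n IH].
  by rewrite big_geq// II0 bigcup_set0 indic0.
rewrite big_nat_recr//= IH mul1r.
rewrite IIS bigcup_setU bigcup_set1 !indicE in_setU.
have [|_] := boolP (x \in \bigcup_(i in `I_n) E i); last by rewrite add0r.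
rewrite inE => -[i /= ilt Eix]; rewrite memNset ?addr0//= => Enx.
have iE : i = n by apply: tE => //; exists x.
by rewrite iE ltnn in ilt.
Qed.

Section functional.
Variables (C : R) (Phi : (T -> R) -> R).
Hypothesis bPhi : bounded_functional mu C Phi.

(** The indicators of the finite unions converge pointwise to that of the whole union, which also
    dominates them, so [functional_cvg] applies. *)
Lemma functional_bigcup (E : (set T)^nat) :
  (forall i, measurable (E i)) -> trivIset setT E -> L1 mu \1_(\bigcup_i E i) ->
  \sum_(0 <= i < n) Phi \1_(E i) @[n --> \oo] --> Phi \1_(\bigcup_i E i).
Proof.
move=> mE tE UE.
have mono n x : \1_(\bigcup_(i in `I_n) E i) x <= \1_(\bigcup_i E i) x :> R.
  rewrite !indicE; have [|_] := boolP (x \in \bigcup_(i in `I_n) E i) => //.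
  by rewrite inE => -[i _ Ex]; rewrite mem_set//; exists i.
have Ei i : L1 mu \1_(E i).
  apply: (le_L1 _ _ UE) => // x; rewrite !ger0_norm//.
  rewrite !indicE; have [|_] := boolP (x \in E i) => //.
  by rewrite inE => Ex; rewrite mem_set//; exists i.
have mU n : measurable (\bigcup_(i in `I_n) E i) by exact: bigcup_measurable.
have mf_ n : measurable_fun setT (\1_(\bigcup_(i in `I_n) E i) : T -> R) by [].
have bf_ n x : `|\1_(\bigcup_(i in `I_n) E i) x| <= \1_(\bigcup_i E i) x :> R.
  by rewrite ger0_norm.
have [|_] := functional_cvg bPhi (f := \1_(\bigcup_i E i)) mf_ UE bf_.
  move=> x; apply: cvg_near_cst.
  have [[k _ Ekx]|nE] := pselect ((\bigcup_i E i) x).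
    exists k.+1 => // n /= kn; rewrite !indicE !mem_set//; first by exists k.
    by exists k.
  apply: nearW => n; rewrite !indicE !memNset// => -[i _ Ex]; apply: nE.
  by exists i.
 apply: cvg_trans; apply: near_eq_cvg; apply: nearW => n.
have [_] := functional_sum bPhi (index_iota 0 n) (fun=> 1) Ei.
under eq_bigr do rewrite mul1r.
by move=> <-; congr Phi; apply/funext => x; rewrite sum_indic_disjoint.
Qed.

(** The vanishing spreads from subsets of the [F k] to sets with indicator in L^1 by countable
    additivity, to simple functions by linearity, to nonnegative functions by monotone approximation
    under domination, and then to all of L^1. *)
Lemma functional_eq0 (F : (set T)^nat) : (forall k, measurable (F k)) ->
  trivIset setT F -> \bigcup_k F k = setT ->
  (forall A k, measurable A -> Phi \1_(A `&` F k) = 0) ->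
  forall f, L1 mu f -> Phi f = 0.
Proof.
move=> mF tF UF PhiF.
have PhiI A : measurable A -> L1 mu \1_A -> Phi \1_A = 0.
  move=> mA iA; have AE : \bigcup_k (A `&` F k) = A.
    by rewrite -setI_bigcupr UF setIT.
  have tAF : trivIset setT (fun k => A `&` F k) by exact: trivIset_setIl.
  have := @functional_bigcup (fun k => A `&` F k).
  rewrite AE => /(_ (fun k => measurableI _ _ mA (mF k)) tAF iA).
  under eq_fun do under eq_bigr do rewrite PhiF//.
  under eq_fun do rewrite big1_eq.
  by move/cvg_unique => /(_ _ 0) -> //; exact: cvg_cst.
have Phis (h : {nnsfun T >-> R}) : L1 mu h -> Phi h = 0.
  move=> hi.
  pose s := fset_set (h @` setT).
  (* The zero level set of [h] may have infinite measure and its indicator may lie outside L^1; its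
     coefficient is 0, so it is replaced by the zero function. *)
  pose e (i : 'I_#|`s|) : T -> R :=
    if s`_i == 0 then cst 0 else \1_(h @^-1` [set s`_i]).
  have ei i : L1 mu (e i).
    rewrite /e; case: eqVneq => [_|s0]; first exact: L1_0.
    apply: (le_L1 _ _ (L1Z (s`_i)^-1 hi)) => // x.
    rewrite indicE; have [|_] := boolP (x \in _); last by rewrite normr0.
    by rewrite inE /= => ->; rewrite mulVf.
  have -> : (h : T -> R) =
      fun x => \sum_(i <- index_enum 'I_#|`s|) s`_i * e i x.
    apply/funext => x; rewrite [LHS]fimfunEord; apply: eq_bigr => i _.
    by rewrite /e; case: eqVneq => [->|//]; rewrite !mul0r.
  have [_ ->] := functional_sum bPhi (index_enum 'I_#|`s|) (fun i => s`_i) ei.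
  rewrite big1// => i _; rewrite /e; case: eqVneq => [_|s0].
    by rewrite (functional0 bPhi) mulr0.
  have := ei i; rewrite /e (negbTE s0) => ii.
  by rewrite PhiI ?mulr0.
have Phip f : (forall x, 0 <= f x) -> L1 mu f -> Phi f = 0.
  move=> f0 fi.
  have mf : measurable_fun setT (EFin \o f) by exact: measurable_int fi.
  have f0' x : setT x -> (0 <= (EFin \o f) x)%E by rewrite lee_fin.
  pose f_ n : {nnsfun T >-> R} := nnsfun_approx measurableT mf n.
  have f_le n x : `|f_ n x| <= f x.
    rewrite ger0_norm// /f_ nnsfun_approxE -lee_fin.
    exact: (@le_approx _ _ _ setT (EFin \o f) n x f0').
  have mf_ n : measurable_fun setT (f_ n) by [].
  have ff x : f_ ^~ x n @[n --> \oo] --> f x.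
    have := cvg_nnsfun_approx measurableT mf f0' (x := x) Logic.I.
    by move=> /fine_cvgP[_]; exact.
  have [_] := functional_cvg bPhi mf_ fi f_le ff.
  have Phif n : Phi (f_ n) = 0.
    apply/Phis/(le_L1 _ _ fi) => // x.
    by rewrite (le_trans (f_le _ _))// ler_norm.
  under eq_fun do rewrite Phif.
  by move/cvg_unique => /(_ _ 0) -> //; exact: cvg_cst.
(* Both the absolute value of [f] and its sum with [f] are nonnegative, and [f] is their
   difference. *)
move=> f fi; have fi' := L1_norm fi.
have := functionalD bPhi fi' fi.
rewrite (Phip _ _ fi')// add0r => <-; apply: Phip.
  by move=> x; have := ler_norm (- f x); rewrite normrN; lra.
by have := L1_linear 1 fi' fi; under eq_fun do rewrite mul1r.
Qed.

End functional.
End countable_additivity.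

(** * Representation of bounded functionals by bounded densities *)

Section L1_dual.
Context d (T : measurableType d) (R : realType).
Variable mu : {sigma_finite_measure set T -> \bar R}.
Implicit Types (f g : T -> R) (Phi : (T -> R) -> R).

(** On the part of [F] where [h > s], the integral of [h - s] is at most 0 by hypothesis although
    the integrand is positive, so that part is a null set. *)
Lemma ae_le_of_Rintegral (F : set T) h (s : R) : measurable F ->
  (mu F < +oo)%E -> L1 mu h ->
  (forall A, measurable A -> A `<=` F ->
     \int[mu]_(x in A) h x <= s * fine (mu A)) ->
  {ae mu, forall x, F x -> h x <= s}.
Proof.
move=> mF muF hi hs; have mh := L1_measurable hi.
pose A := F `&` [set x | s < h x].
have mA : measurable A.
  apply: measurableI => //; rewrite -[X in measurable X]setTI.
  exact: measurable_fun_ltr.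
have AF : A `<=` F by move=> x [].
have hiA : mu.-integrable A (EFin \o h) by exact: integrableS hi.
have muA : (mu A < +oo)%E by apply: le_lt_trans muF; rewrite le_measure ?inE.
have siA : mu.-integrable A (EFin \o cst s).
  apply/integrableP; split; first exact/measurable_EFinP.
  by rewrite /comp/= integral_cst// lte_mul_pinfty.
have kiA : mu.-integrable A (fun x => (h x - s)%:E).
  exact: integrableB hiA siA.
have k0 : (\int[mu]_(x in A) `|(h x - s)%:E| = 0)%E.
  have -> : (\int[mu]_(x in A) `|(h x - s)%:E| =
      \int[mu]_(x in A) (h x - s)%:E)%E.
    apply: eq_integral => x; rewrite inE => -[_ /= sh].
    by rewrite ger0_norm// subr_ge0 ltW.
  apply/eqP; rewrite eq_le; apply/andP; split; last first.
    by apply: integral_ge0 => x [_ /= sh]; rewrite lee_fin subr_ge0 ltW.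
  rewrite -[X in (X <= _)%E]fineK; last exact: integrable_fin_num.
  rewrite lee_fin -/(Rintegral mu A (fun x => h x - s)) RintegralB//.
  by rewrite Rintegral_cst// subr_le0 hs.
have := (ae_eq_integral_abs mu mA (measurable_int _ kiA)).1 k0.
apply: filterS => x /= Ax Fx; rewrite leNgt; apply/negP => sh.
have : (h x - s)%:E = 0 by exact: Ax.
by move=> [] /eqP; rewrite subr_eq0 => /eqP hE; rewrite hE ltxx in sh.
Qed.

Section functional.
Variables (C : R) (Phi : (T -> R) -> R).
Hypothesis C0 : 0 <= C.
Hypothesis bPhi : bounded_functional mu C Phi.

(** Finite measure of [F] keeps the indicators of its subsets in L^1, so that [A] maps to
    [Phi \1_(A]&[F)] as a finite signed measure dominated by [mu]. Its Radon-Nikodym density and the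
    opposite of that density are at most [C] almost everywhere on [F], by comparing averages. *)
Lemma functional_indic_density (F : set T) : measurable F -> (mu F < +oo)%E ->
  exists h : T -> R, [/\ measurable_fun setT h, forall x, `|h x| <= C &
    forall A, measurable A ->
      Phi \1_(A `&` F) = \int[mu]_x (h x * \1_(A `&` F) x)].
Proof.
move=> mF muF; have [_ Pb] := bPhi.
have AFi A : measurable A -> L1 mu \1_(A `&` F).
  move=> mA; have mAF : measurable (A `&` F) by exact: measurableI.
  apply: L1_indic => //.
  by apply: le_lt_trans muF; rewrite le_measure ?inE.
have PA A : measurable A -> `|Phi \1_(A `&` F)| <= C * fine (mu (A `&` F)).
  move=> mA; have mAF : measurable (A `&` F) by exact: measurableI.
  apply: le_trans (Pb _ (AFi _ mA)) _.
  rewrite (@eq_Rintegral _ _ _ mu setT \1_(A `&` F)); last first.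
    by move=> x _; rewrite ger0_norm.
  by rewrite /Rintegral integral_indic// setIT.
pose nu A := (Phi \1_(A `&` F))%:E.
have nu0 : nu set0 = 0 by rewrite /nu set0I indic0 (functional0 bPhi).
have nufin A : measurable A -> nu A \is a fin_num by [].
have nusig : semi_sigma_additive nu.
  move=> E mE tE mUE; apply: cvg_EFin.
    by apply: nearW => n; rewrite sumEFin.
  have := @functional_bigcup _ _ _ mu C Phi bPhi (fun i => E i `&` F).
  rewrite -setI_bigcupl => /(_ _ _ (AFi _ mUE)) H.
  apply: cvg_trans (H _ _).
  - by apply: near_eq_cvg; apply: nearW => n /=; rewrite sumEFin.
  - by move=> i; exact: measurableI.
  - exact: trivIset_setIr.
pose nuC : {charge set T -> \bar R} :=
  HB.pack nu (isCharge.Build d T R nu nu0 nufin nusig).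
have numu : nuC `<< mu.
  apply/null_content_dominatesP => A mA muA0; rewrite /= /nu.
  have mAF : measurable (A `&` F) by exact: measurableI.
  have := PA _ mA; rewrite (_ : mu (A `&` F) = 0); last first.
    by apply/eqP; rewrite eq_le measure_ge0 andbT -muA0 le_measure ?inE.
  by rewrite mulr0 normr_le0 => /eqP ->.
pose h x := fine (Radon_Nikodym nuC mu x).
have hE : EFin \o h = Radon_Nikodym nuC mu.
  by apply/funext => x /=; rewrite fineK// Radon_Nikodym_fin_num.
have hi : L1 mu h by rewrite /L1 hE; exact: Radon_Nikodym_integrable.
have Ph A : measurable A -> Phi \1_(A `&` F) = \int[mu]_(x in A) h x.
  move=> mA; have := Radon_Nikodym_integral numu mA.
  by rewrite /Rintegral -[fun x => (h x)%:E]/(EFin \o h) hE => <-.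
have up : {ae mu, forall x, F x -> h x <= C}.
  apply: ae_le_of_Rintegral => // A mA AF.
  rewrite -Ph// (le_trans (ler_norm _))// (le_trans (PA _ mA))//.
  by rewrite setIidl.
have lo : {ae mu, forall x, F x -> - h x <= C}.
  apply: ae_le_of_Rintegral => //.
    by have := L1Z (-1) hi; under eq_fun do rewrite mulN1r.
  move=> A mA AF; under eq_Rintegral do rewrite -mulN1r.
  rewrite RintegralZl//; last exact: integrableS hi.
  rewrite -Ph// mulN1r (le_trans (ler_norm _))// normrN (le_trans (PA _ mA))//.
  by rewrite setIidl.
have mh := L1_measurable hi.
(* Clamping to the interval from [- C] to [C] turns the almost everywhere bound into a pointwise
   one. *)
pose g x := Num.max (- C) (Num.min (h x) C).
have mg : measurable_fun setT g.
  by apply: measurable_maxr => //; exact: measurable_minr.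
have gC x : `|g x| <= C.
  rewrite ler_norml /g le_max lexx ge_max ge_min lexx orbT andbT.
  by rewrite (le_trans _ C0)// oppr_le0.
exists g; split => // A mA.
have mAF : measurable (A `&` F) by exact: measurableI.
(* The density formula is used for [A]&[F] in place of [A]: the integral then stays inside [F],
   where clamping changes [h] only on a null set. *)
transitivity (Phi \1_((A `&` F) `&` F)); first by rewrite -setIA setIid.
rewrite Ph//.
transitivity (\int[mu]_(x in A `&` F) g x); last first.
  rewrite Rintegral_mkcond; apply: eq_Rintegral => x _.
  by rewrite patchE indicE; case: ifP; rewrite ?mulr1 ?mulr0.
congr fine; apply: ae_eq_integral => //.
- by apply/measurable_EFinP; exact: measurable_funTS.
- by apply/measurable_EFinP; exact: measurable_funTS.
apply: filterS2 up lo => x up lo /= [_ Fx]; congr EFin.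
rewrite /g (min_idPl (up Fx)); apply/esym/max_idPr.
by rewrite lerNl lo.
Qed.

(** The densities on a partition into sets of finite measure share the bound [C] and are glued to
    [g]. The functional minus integration against [g] is bounded and vanishes on subsets of each
    part, hence everywhere by [functional_eq0]. *)
Theorem L1_dual : exists g, [/\ measurable_fun setT g, forall x, `|g x| <= C &
  forall f, L1 mu f -> Phi f = \int[mu]_x (g x * f x)].
Proof.
have [F0 UF0 mF0] := sigma_finiteT mu.
pose F := seqDU F0.
have mF k : measurable (F k).
  apply: measurableD; first exact: (mF0 k).1.
  by apply: bigsetU_measurable => i _; exact: (mF0 i).1.
have muF k : (mu (F k) < +oo)%E.
  apply: le_lt_trans (mF0 k).2; apply: le_measure; rewrite ?inE//.
    exact: (mF0 k).1.
  exact: subDsetl.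
have tF : trivIset setT F by exact: trivIset_seqDU.
have UF : \bigcup_k F k = setT by rewrite -seqDU_bigcup_eq.
have /boolp.choice[h hP] : forall k, exists h : T -> R,
    [/\ measurable_fun setT h, forall x, `|h x| <= C &
    forall A, measurable A ->
      Phi \1_(A `&` F k) = \int[mu]_x (h x * \1_(A `&` F k) x)].
  by move=> k; exact: functional_indic_density.
have /boolp.choice[k kP] : forall x, exists k, F k x.
  move=> x; have [k _ Fkx] : (\bigcup_k F k) x by rewrite UF.
  by exists k.
pose g x := h (k x) x.
have gF i x : F i x -> g x = h i x.
  move=> Fx; rewrite /g; have -> // : k x = i by apply: tF => //; exists x.
have mg : measurable_fun setT g.
  rewrite -UF; apply/measurable_fun_bigcup => // i.
  have [mh _ _] := hP i; apply: eq_measurable_fun (measurable_funTS mh).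
  by move=> x; rewrite inE => /gF.
have gC x : `|g x| <= C by have [_ hC _] := hP (k x); exact: hC.
exists g; split => // f fi; apply/eqP; rewrite -subr_eq0; apply/eqP.
have bD := bounded_functionalB bPhi (bounded_functional_mul mu mg gC).
apply: (functional_eq0 bD mF tF UF _ fi) => A i mA.
have [_ _ ->//] := hP i; apply/eqP; rewrite subr_eq0; apply/eqP.
apply: eq_Rintegral => x _; rewrite indicE.
have [|_] := boolP (x \in _); last by rewrite !mulr0.
by rewrite inE => -[_ /gF ->].
Qed.

End functional.
End L1_dual.

(** * Complex-valued functions *)

Section modulus.
Context (R : realType).
Local Notation normc := Normc.normc.

Lemma normc_ge0 (z : R[i]) : 0 <= normc z.
Proof. by case: z => a b; exact: sqrtr_ge0. Qed.

Lemma normc_ge_abs_Re (z : R[i]) : `|complex.Re z| <= normc z.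
Proof.
by case: z => a b /=; rewrite -sqrtr_sqr ler_wsqrtr// lerDl sqr_ge0.
Qed.

Lemma normc_ge_abs_Im (z : R[i]) : `|complex.Im z| <= normc z.
Proof.
by case: z => a b /=; rewrite -sqrtr_sqr ler_wsqrtr// lerDr sqr_ge0.
Qed.

Lemma normc_conj (z : R[i]) : normc (z^*)%C = normc z.
Proof. by case: z => a b /=; rewrite sqrrN. Qed.

Lemma normc_real (r : R) : normc (r%:C)%C = `|r|.
Proof. by rewrite /= expr0n addr0 sqrtr_sqr. Qed.

Lemma mul_conjc (z : R[i]) : z * (z^*)%C = ((normc z) ^+ 2)%:C%C.
Proof.
case: z => a b; apply/eqP; rewrite eq_complex/= sqr_sqrtr ?addr_ge0 ?sqr_ge0//.
by apply/andP; split; apply/eqP; ring.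
Qed.

Lemma normc_le_ReIm (z : R[i]) :
  normc z <= `|complex.Re z| + `|complex.Im z|.
Proof.
case: z => a b /=.
rewrite -[leRHS]ger0_norm ?addr_ge0// -sqrtr_sqr ler_wsqrtr//.
by rewrite sqrrD !real_normK ?num_real// lerD2r lerDl mulrn_wge0 ?mulr_ge0.
Qed.

End modulus.

Section complex_L1.
Context d (T : measurableType d) (R : realType).
Variable mu : {sigma_finite_measure set T -> \bar R}.
Local Notation normc := Normc.normc.

Definition measurable_funC (D : set T) (F : T -> R[i]) :=
  measurable_fun D (fun x => complex.Re (F x)) /\
  measurable_fun D (fun x => complex.Im (F x)).

(** Inversion is continuous off 0, and on the remaining point it is constant because the inverse of
    0 is 0. *)
Lemma measurable_invr : measurable_fun setT (@GRing.inv R).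
Proof.
rewrite -(setUv [set 0]); apply/measurable_funU => //; first exact: measurableC.
split.
  apply: (eq_measurable_fun (cst 0 : R -> R)) => [x|]; last first.
    exact: measurable_cst.
  by rewrite inE => /= ->; rewrite invr0.
apply: open_continuous_measurable_fun.
  by apply: closed_openC; exact: closed_eq.
by move=> x; rewrite inE => /= /eqP x0; exact: inv_continuous.
Qed.

Lemma measurable_normc D F : measurable_funC D F ->
  measurable_fun D (fun x => normc (F x)).
Proof.
move=> [mR mI].
rewrite (_ : (fun _ => _) = fun x =>
  Num.sqrt (complex.Re (F x) ^+ 2 + complex.Im (F x) ^+ 2)); last first.
  by apply/funext => x; case: (F x).
apply: measurableT_comp.
  by apply: continuous_measurable_fun; exact: sqrt_continuous.
by apply: measurable_funD; exact: measurable_funX.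
Qed.

Lemma measurable_funC_mul D F G : measurable_funC D F -> measurable_funC D G ->
  measurable_funC D (fun x => F x * G x).
Proof.
move=> [mFR mFI] [mGR mGI]; split.
  rewrite (_ : (fun _ => _) = fun x => complex.Re (F x) * complex.Re (G x) -
     complex.Im (F x) * complex.Im (G x)); last first.
    by apply/funext => x; case: (F x) (G x) => a b [].
  by apply: measurable_funB; exact: measurable_funM.
rewrite (_ : (fun _ => _) = fun x => complex.Re (F x) * complex.Im (G x) +
     complex.Im (F x) * complex.Re (G x)); last first.
  by apply/funext => x; case: (F x) (G x) => a b [].
by apply: measurable_funD; exact: measurable_funM.
Qed.

Lemma measurable_funC_inv D F : measurable_funC D F ->
  measurable_funC D (fun x => (F x)^-1).
Proof.
move=> [mR mI].
have mN : measurable_fun D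
    (fun x => (complex.Re (F x) ^+ 2 + complex.Im (F x) ^+ 2)^-1).
  apply: (measurableT_comp measurable_invr).
  by apply: measurable_funD; exact: measurable_funX.
split.
  rewrite (_ : (fun _ => _) = fun x => complex.Re (F x) *
    (complex.Re (F x) ^+ 2 + complex.Im (F x) ^+ 2)^-1).
    exact: measurable_funM.
  by apply/funext => x; case: (F x).
rewrite (_ : (fun _ => _) = fun x => - (complex.Im (F x) *
    (complex.Re (F x) ^+ 2 + complex.Im (F x) ^+ 2)^-1)).
  by apply: measurable_funN; exact: measurable_funM.
by apply/funext => x; case: (F x).
Qed.

Lemma measurable_funC_conj D F : measurable_funC D F ->
  measurable_funC D (fun x => ((F x)^*)%C).
Proof.
move=> [mR mI]; split.
  by rewrite (_ : (fun _ => _) = fun x => complex.Re (F x))//;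
    apply/funext => x; case: (F x).
rewrite (_ : (fun _ => _) = fun x => - complex.Im (F x)).
  exact: measurable_funN.
by apply/funext => x; case: (F x).
Qed.

Lemma measurable_funC_cst D (z : R[i]) : measurable_funC D (fun=> z).
Proof. by split; exact: measurable_cst. Qed.

Lemma measurable_funCB D F G : measurable_funC D F -> measurable_funC D G ->
  measurable_funC D (fun x => F x - G x).
Proof.
move=> [mFR mFI] [mGR mGI]; split.
  rewrite (_ : (fun _ => _) = fun x => complex.Re (F x) - complex.Re (G x)).
    exact: measurable_funB.
  by apply/funext => x; case: (F x) (G x) => a b [].
rewrite (_ : (fun _ => _) = fun x => complex.Im (F x) - complex.Im (G x)).
  exact: measurable_funB.
by apply/funext => x; case: (F x) (G x) => a b [].
Qed.

Lemma measurable_funC_restrict D F : measurable D -> measurable_funC D F ->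
  measurable_funC setT (fun x => if x \in D then F x else 0).
Proof.
move=> mD [/(measurable_restrictT _ mD) mR /(measurable_restrictT _ mD) mI].
split.
  rewrite (_ : (fun _ => _) = (fun x => complex.Re (F x)) \_ D)//.
  by apply/funext => x; rewrite patchE; case: ifP.
rewrite (_ : (fun _ => _) = (fun x => complex.Im (F x)) \_ D)//.
by apply/funext => x; rewrite patchE; case: ifP.
Qed.

Lemma eq_measurable_funC D F G : {in D, F =1 G} -> measurable_funC D F ->
  measurable_funC D G.
Proof.
move=> FG [mR mI]; split.
  by apply: eq_measurable_fun mR => x xD; rewrite FG.
by apply: eq_measurable_fun mI => x xD; rewrite FG.
Qed.

Lemma measurable_funCS D E F : measurable E -> D `<=` E ->
  measurable_funC E F -> measurable_funC D F.
Proof. by move=> mE DE [mR mI]; split; exact: measurable_funS mE DE _. Qed.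

Definition L1c (F : T -> R[i]) :=
  L1 mu (fun x => complex.Re (F x)) /\ L1 mu (fun x => complex.Im (F x)).

Lemma L1c_measurable F : L1c F -> measurable_funC setT F.
Proof. by move=> [/L1_measurable ? /L1_measurable]. Qed.

Lemma L1c_norm F : L1c F -> L1 mu (fun x => normc (F x)).
Proof.
move=> iF; have mN := measurable_normc (L1c_measurable iF).
case: iF => iR iI; apply: (le_L1 mN _ (L1_linear 1 (L1_norm iR) (L1_norm iI))).
move=> x; rewrite mul1r (ger0_norm (normc_ge0 _)) ger0_norm ?addr_ge0//.
exact: normc_le_ReIm.
Qed.

Lemma L1c_of_norm F : measurable_funC setT F -> L1 mu (fun x => normc (F x)) ->
  L1c F.
Proof.
move=> [mR mI] iN; split; [apply: (le_L1 mR _ iN)|apply: (le_L1 mI _ iN)] => x.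
  by rewrite (ger0_norm (normc_ge0 _)) normc_ge_abs_Re.
by rewrite (ger0_norm (normc_ge0 _)) normc_ge_abs_Im.
Qed.

Lemma L1c_mul C G F : measurable_funC setT G -> (forall x, normc (G x) <= C) ->
  L1c F -> L1c (fun x => G x * F x).
Proof.
move=> mG GC iF; have mGF := measurable_funC_mul mG (L1c_measurable iF).
apply: (L1c_of_norm mGF).
apply: (le_L1 (measurable_normc mGF) _ (L1Z C (L1c_norm iF))).
move=> x; rewrite Normc.normcM !normrM.
rewrite (ger0_norm (normc_ge0 (F x))) ler_wpM2r ?normc_ge0//.
by rewrite ger0_norm ?normc_ge0// (le_trans (GC x))// ler_norm.
Qed.

(** [Rcomplex R] is the complex plane as a real vector space, the structure over which [hahn_banach]
    is stated. *)
Lemma L1c_subspace : subspace_set (L1c : set (T -> Rcomplex R)).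
Proof.
split; first by split; exact: L1_0.
move=> c F G [FR FI] [GR GI]; split.
  rewrite (_ : (fun _ => _) = fun x => c * complex.Re (F x) + complex.Re (G x)).
    exact: L1_linear.
  apply/funext => x; rewrite -[(c *: F + G) x]/(c *: F x + G x).
  by case: (F x) (G x) => [a b] [].
rewrite (_ : (fun _ => _) = fun x => c * complex.Im (F x) + complex.Im (G x)).
  exact: L1_linear.
apply/funext => x; rewrite -[(c *: F + G) x]/(c *: F x + G x).
  by case: (F x) (G x) => [a b] [].
Qed.

End complex_L1.

(** * Extension and representation of real functionals on complex L^1 *)

Section extension.
Context d (T : measurableType d) (R : realType).
Variable mu : {sigma_finite_measure set T -> \bar R}.
Local Notation normc := Normc.normc.
Local Notation CT := (T -> Rcomplex R).

Lemma Rintegral_normcZ (c : R) (F : CT) : 0 <= c -> L1c mu F ->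
  \int[mu]_x normc ((c *: F) x) = c * \int[mu]_x normc (F x).
Proof.
move=> c0 iF; rewrite -RintegralZl//; last exact: L1c_norm.
apply: eq_Rintegral => x _; rewrite -[(c *: F) x]/(c *: F x).
have -> : c *: F x = (c%:C)%C * F x.
  case: (F x) => a b; apply/eqP.
  by rewrite eq_complex/= !mul0r subr0 addr0 !eqxx.
by rewrite Normc.normcM/= expr0n addr0 sqrtr_sqr ger0_norm.
Qed.

Lemma Rintegral_normcD (F G : CT) : L1c mu F -> L1c mu G ->
  \int[mu]_x normc ((F + G) x) <=
  \int[mu]_x normc (F x) + \int[mu]_x normc (G x).
Proof.
move=> iF iG; rewrite -RintegralD//; [|exact: L1c_norm..].
apply: le_Rintegral => //.
- by apply/L1c_norm/(subspace_setD (L1c_subspace mu)).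
- have := L1_linear 1 (L1c_norm iF) (L1c_norm iG).
  by under eq_fun do rewrite mul1r.
- by move=> x _; exact: le_normcD.
Qed.

Lemma complex_linear (c a b a' b' : R) :
  c *: ((a +i* b)%C : Rcomplex R) + ((a' +i* b')%C : Rcomplex R) =
  ((c * a + a') +i* (c * b + b'))%C.
Proof. by []. Qed.

Lemma L1c_Re (f : T -> R) : L1 mu f -> L1c mu (fun x => (f x +i* 0)%C).
Proof. by move=> fi; split => //; exact: L1_0. Qed.

Lemma L1c_Im (f : T -> R) : L1 mu f -> L1c mu (fun x => (0 +i* f x)%C).
Proof. by move=> fi; split => //; exact: L1_0. Qed.

(* The extended functional has the form [F |-> Phi1 (Re F) + Phi2 (Im F)], where
   [Phi1] and [Phi2] have densities [Re g0] and [- Im g0] bounded by [C]; testing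
   on [conj g0 / |g0|] improves these bounds to [|g0| <= C]. *)
Theorem functional_extension_dual (C : R) (W : set CT) (l : CT -> R) :
  0 <= C -> subspace_set W -> W `<=` L1c mu -> linear_on W l ->
  (forall F, W F -> l F <= C * \int[mu]_x normc (F x)) ->
  exists g : T -> R[i], [/\ measurable_funC setT g, forall x, normc (g x) <= C &
    forall F, W F -> l F = \int[mu]_x complex.Re (g x * F x)].
Proof.
move=> C0 subW WL ll lC.
pose p (F : CT) := C * \int[mu]_x normc (F x).
have pZ (c : R) (F : CT) : 0 < c -> L1c mu F -> p (c *: F) = c * p F.
  by move=> c0 iF; rewrite /p Rintegral_normcZ ?ltW// mulrCA.
have pD (F G : CT) : L1c mu F -> L1c mu G -> p (F + G) <= p F + p G.
  by move=> iF iG; rewrite /p -mulrDr ler_wpM2l// Rintegral_normcD.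
have [L [Ll LW Lp]] := hahn_banach (L1c_subspace mu) pZ pD subW WL ll lC.
have subL := L1c_subspace mu.
have Labs (F : CT) : L1c mu F -> `|L F| <= C * \int[mu]_x normc (F x).
  move=> iF; have L0 := subL.1; rewrite ler_norml Lp// andbT.
  have := Ll (-1) F 0 iF L0; have := Ll 1 0 0 L0 L0.
  rewrite scale1r !addr0 => ? NE.
  have : L (- F) <= p (- F).
    by apply: Lp; rewrite -scaleN1r; exact: subspace_setZ.
  rewrite scaleN1r in NE; rewrite NE.
  rewrite /p (@eq_Rintegral _ _ _ mu setT (fun x => normc (F x))); first lra.
  by move=> x _; exact: normcN.
have bound (f : T -> R) (F : CT) : L1 mu f -> L1c mu F ->
    (forall x, normc (F x) = `|f x|) -> `|L F| <= C * \int[mu]_x `|f x|.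
  move=> fi iF Ff; apply: le_trans (Labs _ iF) _.
  by rewrite (@eq_Rintegral _ _ _ mu setT (fun x => `|f x|)).
pose Phi1 (f : T -> R) := L (fun x => (f x +i* 0)%C).
pose Phi2 (f : T -> R) := L (fun x => (0 +i* f x)%C).
have b1 : bounded_functional mu C Phi1.
  split=> [c f h fi hi|f fi]; last first.
    apply: (bound _ _ fi (L1c_Re fi)) => x.
    by rewrite /= expr0n addr0 sqrtr_sqr.
  rewrite /Phi1 -Ll; [|exact: L1c_Re..]; congr L; apply/funext => x.
  by rewrite [RHS]complex_linear mulr0 addr0.
have b2 : bounded_functional mu C Phi2.
  split=> [c f h fi hi|f fi]; last first.
    apply: (bound _ _ fi (L1c_Im fi)) => x.
    by rewrite /= expr0n add0r sqrtr_sqr.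
  rewrite /Phi2 -Ll; [|exact: L1c_Im..]; congr L; apply/funext => x.
  by rewrite [RHS]complex_linear mulr0 addr0.
have [g1 [mg1 g1C g1E]] := L1_dual C0 b1.
have [g2 [mg2 g2C g2E]] := L1_dual C0 b2.
(* The sign is dictated by Re ((g1 - i g2) (a + i b)) = g1 a + g2 b. *)
pose g0 x : R[i] := (g1 x -i* g2 x)%C.
have mg0 : measurable_funC setT g0 by split => //; exact: measurable_funN.
have LE (F : CT) : L1c mu F -> L F = \int[mu]_x complex.Re (g0 x * F x).
  move=> [FR FI].
  pose F1 : CT := fun x => (complex.Re (F x) +i* 0)%C.
  pose F2 : CT := fun x => (0 +i* complex.Im (F x))%C.
  have FE : F = 1 *: F1 + F2.
    apply/funext => x; rewrite [RHS]complex_linear mulr0 addr0 add0r mul1r.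
    by case: (F x).
  rewrite [in LHS]FE Ll; [|exact: L1c_Re|exact: L1c_Im].
  rewrite mul1r -/(Phi1 _) -/(Phi2 _) g1E// g2E// -RintegralD//; last 2 first.
    - exact: (L1_mul mg1 g1C).
    - exact: (L1_mul mg2 g2C).
  by apply: eq_Rintegral => x _; case: (F x) => a b /=; rewrite mulNr opprK.
have mN0 := measurable_normc mg0.
(* This crude bound only ensures integrability of products with [g0]. *)
have g0C x : normc (g0 x) <= 2 * C.
  have g0E : g0 x = (g1 x)%:C%C + (0 -i* g2 x)%C.
    by apply/eqP; rewrite eq_complex/= addr0 add0r !eqxx.
  rewrite g0E; apply: le_trans (le_normcD _ _) _.
  rewrite /= expr0n addr0 add0r !sqrtr_sqr normrN.
  by have := g1C x; have := g2C x; lra.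
have aeC : {ae mu, forall x, normc (g0 x) <= C}.
  have [F0 UF mF0] := sigma_finiteT mu.
  suff : forall k, {ae mu, forall x, F0 k x -> normc (g0 x) <= C}.
    move=> /ae_foralln; apply: filterS => x H.
    by have : [set: T] x by []; rewrite UF => -[k _ /H].
  move=> k; have [mF muF] := mF0 k.
  have iF := L1_indic mF muF.
  have hi : L1 mu (fun x => normc (g0 x) * \1_(F0 k) x).
    by apply: (@L1_mul _ _ _ mu (2 * C)) => // x; rewrite ger0_norm ?normc_ge0.
  suff : {ae mu, forall x, F0 k x -> normc (g0 x) * \1_(F0 k) x <= C}.
    by apply: filterS => x H Fx; have := H Fx; rewrite indicE mem_set// mulr1.
  apply: ae_le_of_Rintegral => // A mA AF.
  have muA : (mu A < +oo)%E by apply: le_lt_trans muF; rewrite le_measure ?inE.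
  have iA := L1_indic mA muA.
  (* On [A] this is conj g0 / |g0|, and 0 where [g0] vanishes since the inverse of 0 is 0. As
     [g0 * u] is |g0| on [A], the bound on [L u] says that |g0| has average at most [C] over [A]. *)
  pose u x : R[i] := ((normc (g0 x))^-1 * \1_A x)%:C%C * (g0 x)^*%C.
  have nu x : normc (u x) <= \1_A x.
    rewrite Normc.normcM normc_conj normc_real.
    rewrite ger0_norm ?mulr_ge0 ?invr_ge0 ?normc_ge0// mulrAC.
    have [->|n0] := eqVneq (normc (g0 x)) 0; first by rewrite mulr0 mul0r.
    by rewrite mulVf// mul1r.
  have mu' : measurable_funC setT u.
    apply: measurable_funC_mul; last first.
      by split => //=; under eq_fun do rewrite opprK.
    split => //=; apply: measurable_funM => //.
    exact: (measurableT_comp (@measurable_invr R)).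
  have iu : L1c mu u.
    apply: L1c_of_norm => //; apply: (le_L1 (measurable_normc mu') _ iA) => x.
    by rewrite !ger0_norm ?normc_ge0.
  have := Labs _ iu; rewrite LE// => H.
  have E1 : \int[mu]_(x in A) (normc (g0 x) * \1_(F0 k) x) =
      \int[mu]_x complex.Re (g0 x * u x).
    rewrite Rintegral_mkcond; apply: eq_Rintegral => x _; rewrite patchE.
    rewrite /u mulrCA mul_conjc.
    rewrite -rmorphM !indicE; have [xA|xA] := boolP (x \in A); last first.
      by rewrite mulr0 mul0r.
    rewrite (mem_set (AF _ (set_mem xA))) !mulr1.
    rewrite -[RHS]/((normc (g0 x))^-1 * (normc (g0 x) ^+ 2)).
    have [->|n0] := eqVneq (normc (g0 x)) 0; first by rewrite invr0 mul0r.
    by rewrite expr2 mulrA mulVf// mul1r.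
  rewrite E1; apply: le_trans (ler_norm _) _; apply: le_trans H _.
  rewrite ler_wpM2l//.
  have <- : \int[mu]_x (\1_A x) = fine (mu A).
    by rewrite /Rintegral integral_indic// setIT.
  by apply: le_Rintegral => //; exact: L1c_norm.
pose g x : R[i] := if normc (g0 x) <= C then g0 x else 0.
have mg : measurable_funC setT g.
  have mb : measurable_fun setT (fun x => normc (g0 x) <= C).
    exact: measurable_fun_ler.
  split.
    rewrite (_ : (fun _ => _) = fun x => if normc (g0 x) <= C then g1 x else 0).
      exact: measurable_fun_ifT.
    by apply/funext => x; rewrite /g; case: ifP.
  rewrite (_ : (fun _ => _) = fun x => if normc (g0 x) <= C then - g2 x else 0).
    by apply: measurable_fun_ifT => //; exact: measurable_funN.
  by apply/funext => x; rewrite /g; case: ifP.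
have gC x : normc (g x) <= C.
  by rewrite /g; case: ifP => //; rewrite Normc.normc0.
exists g; split => // F WF; rewrite -LW// LE; last exact: WL.
have [mF _] := L1c_mul mg gC (WL _ WF).
have [mF' _] := L1c_mul mg0 g0C (WL _ WF).
congr fine; apply: ae_eq_integral => //.
- exact: measurable_int mF'.
- exact: measurable_int mF.
- by apply: filterS aeC => x H _; rewrite /g H.
Qed.

End extension.

(** * Derivatives and Borel sets in the plane *)

Section numField_derivative.
Context (K : numFieldType).
Implicit Types f g : K^o -> K^o.

Lemma derivable1_continuous f z : derivable f z 1 -> {for z, continuous f}.
Proof. by move=> /derivable1_diffP; exact: differentiable_continuous. Qed.

Lemma derive1_comp_numField f g z : derivable f z 1 -> derivable g (f z) 1 ->
  derive1 (g \o f) z = derive1 g (f z) * derive1 f z.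
Proof.
move=> /derivable1_diffP df /derivable1_diffP dg.
rewrite derive1E'; last exact/differentiable_comp.
rewrite diff_comp // !derive1E' //= -[X in 'd  _ _ X = _]mulr1.
by rewrite [LHS]linearZ mulrC.
Qed.

Lemma derivable1_linear c f g z : derivable f z 1 -> derivable g z 1 ->
  derivable (fun w => c * f w + g w : K^o) z 1.
Proof. by move=> df dg; apply: derivableD => //; exact: derivableZ. Qed.

Lemma near_eq_derive1 f g z : (\forall w \near z, f w = g w) ->
  derive1 f z = derive1 g z.
Proof. by move=> fg; rewrite !derive1E; exact: near_eq_derive. Qed.

Lemma derive1_idfun z : derive1 (id : K^o -> K^o) z = 1.
Proof. by rewrite derive1E derive_id. Qed.

Lemma derive1_seq f z (h : nat -> K^o) : derivable f z 1 ->
  (forall n, h n != 0) -> h n @[n --> \oo] --> (0 : K^o) ->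
  (h n)^-1 * (f (h n + z) - f z) @[n --> \oo] --> derive1 f z.
Proof.
move=> df h0 hcvg; rewrite derive1E.
have hcvg' : h n @[n --> \oo] --> (0 : K^o)^'.
  move=> A /= A0.
  have : \forall n \near \oo, h n != 0 -> A (h n) by exact: (hcvg _ A0).
  by apply: filterS => n; apply; exact: h0.
have /(cvg_comp _ _ hcvg') := df.
apply: cvg_trans; apply: near_eq_cvg; apply: nearW => n /=.
by rewrite /shift/= -[_ *: _]/(_ * _) -[h n *: 1]/(h n * 1) mulr1.
Qed.

End numField_derivative.

Section plane.
Context (R : realType).
Local Notation normc := Normc.normc.

Lemma norm_Cplx (z : Cplx R) : `|z| = (normc z)%:C%C.
Proof. by rewrite [LHS]normc_def; case: z. Qed.

Lemma ball_Cplx (z : Cplx R) (e : R) w : 0 < e ->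
  ball z e%:C%C w <-> normc (z - w) < e.
Proof. by move=> e0; rewrite -ball_normE /ball_/= norm_Cplx ltcR. Qed.

(** Balls of [Cplx R] have radii in [R[i]]; a positive element of [R[i]] has zero imaginary part,
    which yields a real radius. *)
Lemma nbhs_Cplx (z : Cplx R) (A : set (Cplx R)) :
  nbhs z A <-> exists2 e : R, 0 < e & forall w, normc (z - w) < e -> A w.
Proof.
split=> [/nbhs_ballP[e /= e0 eA]|[e e0 eA]].
  have [r0 re] : 0 < complex.Re e /\ e = (complex.Re e)%:C%C.
    by case: e e0 {eA} => a b; rewrite ltcE/= => /andP[/eqP -> ?].
  by exists (complex.Re e) => // w wz; apply: eA; rewrite re; exact/ball_Cplx.
apply/nbhs_ballP; exists e%:C%C; first by rewrite /= ltcR.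
by move=> w /(ball_Cplx z w e0) /eA.
Qed.

Lemma Re_continuous : continuous (@complex.Re R : Cplx R -> R).
Proof.
move=> z; apply/(@cvgrPdist_lt _ _ _ (nbhs z)) => e e0.
apply/nbhs_Cplx; exists e => // w.
apply: le_lt_trans.
have -> : complex.Re z - complex.Re w = complex.Re (z - w).
  by case: z w => ? ? [].
exact: normc_ge_abs_Re.
Qed.

Lemma Im_continuous : continuous (@complex.Im R : Cplx R -> R).
Proof.
move=> z; apply/(@cvgrPdist_lt _ _ _ (nbhs z)) => e e0.
apply/nbhs_Cplx; exists e => // w.
apply: le_lt_trans.
have -> : complex.Im z - complex.Im w = complex.Im (z - w).
  by case: z w => ? ? [].
exact: normc_ge_abs_Im.
Qed.

Definition ofC (z : Cplx R) : R * R := (complex.Re z, complex.Im z).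

Lemma toCK : cancel (@toC R) ofC. Proof. by case. Qed.
Definition rat_box (q : rat * rat * (rat * rat)) : set (R * R) :=
  `]ratr q.1.1, ratr q.1.2[%classic `*` `]ratr q.2.1, ratr q.2.2[%classic.

(** An open set is the union of the rational boxes inside it, which are countably many measurable
    rectangles. This ties the topology of [Cplx R] to the product sigma-algebra. *)
Lemma measurable_toC_open (O : set (Cplx R)) : open O ->
  measurable (@toC R @^-1` O).
Proof.
move=> oO.
pose B n : set (R * R) :=
  if @unpickle (rat * rat * (rat * rat))%type n is Some q then
    (if `[< rat_box q `<=` @toC R @^-1` O >] then rat_box q else set0)
  else set0.
suff -> : @toC R @^-1` O = \bigcup_n B n.
  apply: bigcup_measurable => n _; rewrite /B; case: unpickle => // q.
  by case: ifP => // _; exact: measurableX.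
apply/seteqP; split=> [[x y] /= Oxy|p [n _]]; last first.
  by rewrite /B; case: unpickle => // q; case: asboolP => // qO /qO.
have /nbhs_Cplx[e e0 eO] : nbhs (toC (x, y)) O by exact: open_nbhs_nbhs.
(* Half the radius in each coordinate suffices, as the modulus is at most the sum of the absolute
   values of the two parts. *)
have e2 : 0 < e / 2 by rewrite divr_gt0.
have lt1 (a : R) : a - e / 2 < a by rewrite gtrBl.
have lt2 (a : R) : a < a + e / 2 by rewrite ltrDl.
have [a1] := rat_in_itvoo (lt1 x); have [b1] := rat_in_itvoo (lt2 x).
have [a2] := rat_in_itvoo (lt1 y); have [b2] := rat_in_itvoo (lt2 y).
rewrite !in_itv/= => /andP[hb2 hb2'] /andP[ha2 ha2'].
move=> /andP[hb1 hb1'] /andP[ha1 ha1'].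
exists (pickle ((a1, b1), (a2, b2))); first exact: Logic.I.
rewrite /B pickleK asboolT; last first.
  move=> [u v] [] /=; rewrite !in_itv/= => /andP[u1 u2] /andP[v1 v2].
  apply: eO; apply: le_lt_trans (normc_le_ReIm _) _ => /=.
  have : `|x - u| < e / 2 by rewrite ltr_norml; apply/andP; split; lra.
  have : `|y - v| < e / 2 by rewrite ltr_norml; apply/andP; split; lra.
  lra.
by split; rewrite /= in_itv/= ?ha1' ?hb1 ?ha2' ?hb2.
Qed.

Lemma measurable_fun_toC_continuous (f : Cplx R -> R)
    (O : set (Cplx R)) : open O ->
  (forall z, O z -> {for z, continuous f}) ->
  measurable_fun (@toC R @^-1` O) (f \o @toC R).
Proof.
move=> oO cf.
apply: (measurability _ (RGenOInfty.measurableE R)) => _ [_ [a ->] <-].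
have -> : @toC R @^-1` O `&` (f \o @toC R) @^-1` `]a, +oo[ =
    @toC R @^-1` (O `&` f @^-1` `]a, +oo[) by [].
apply: measurable_toC_open; rewrite openE => z [Oz fz].
apply: filterI; first exact: open_nbhs_nbhs.
by apply: cf => //; apply: open_nbhs_nbhs; split => //; exact: interval_open.
Qed.

Lemma measurable_funC_continuous (f : Cplx R -> Cplx R) (O : set (Cplx R)) :
  open O -> (forall z, O z -> {for z, continuous f}) ->
  measurable_funC (@toC R @^-1` O) (f \o @toC R).
Proof.
move=> oO cf; split.
  apply: (@measurable_fun_toC_continuous (@complex.Re R \o f) O oO) => z Oz.
  by apply: continuous_comp; [exact: cf|exact: Re_continuous].
apply: (@measurable_fun_toC_continuous (@complex.Im R \o f) O oO) => z Oz.
by apply: continuous_comp; [exact: cf|exact: Im_continuous].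
Qed.

Lemma measurable_funC_derivable (f : Cplx R -> Cplx R) (O : set (Cplx R)) :
  open O -> (forall z, O z -> derivable f z 1) ->
  measurable_funC (@toC R @^-1` O) (f \o @toC R).
Proof.
move=> oO df; apply: (measurable_funC_continuous oO) => z Oz.
exact: derivable1_continuous (df z Oz).
Qed.

End plane.

Section derivative.
Context (R : realType).
Local Notation normc := Normc.normc.
Implicit Types f g : Cplx R -> Cplx R.

Definition real_step n : Cplx R := (n.+1%:R^-1)%:C%C.

Lemma real_step_neq0 n : real_step n != 0.
Proof. by rewrite eq_complex/= negb_and invr_eq0 pnatr_eq0. Qed.

Lemma real_step_cvg : real_step n @[n --> \oo] --> (0 : Cplx R).
Proof.
move=> A /nbhs_Cplx[e e0 eA].
have /cvgrPdist_lt/(_ _ e0) := @cvg_harmonic R.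
move=> H; have : \forall n \near \oo, A (real_step n) => //.
apply: filterS H => n /=; rewrite sub0r normrN => H; apply: eA.
by rewrite sub0r normcN /= expr0n addr0 sqrtr_sqr.
Qed.

Lemma measurable_real_cvg d (T : measurableType d) (D : set T)
    (F_ : nat -> T -> Cplx R) (F : T -> Cplx R) :
  (forall n, measurable_funC D (F_ n)) ->
  (forall x, D x -> F_ n x @[n --> \oo] --> F x) -> measurable_funC D F.
Proof.
move=> mF cF; split.
  apply: (measurable_fun_cvg (fun n => (mF n).1)) => x Dx.
  by apply: (cvg_comp _ _ (cF x Dx)); exact: Re_continuous.
apply: (measurable_fun_cvg (fun n => (mF n).2)) => x Dx.
by apply: (cvg_comp _ _ (cF x Dx)); exact: Im_continuous.
Qed.

(* The derivative is a limit of measurable difference quotients along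
   [real_step]: its continuity, that is Goursat's theorem, is not needed. *)
Lemma measurable_funC_derive1 f (O : set (Cplx R)) : open O ->
  (forall z, O z -> derivable f z 1) ->
  measurable_funC (@toC R @^-1` O) (fun p => derive1 f (toC p)).
Proof.
move=> oO df; have mO := measurable_toC_open oO.
(* Extension by 0 makes the difference quotients measurable on the whole plane. At a point of the
   open set [O] they are eventually those of [f]. *)
pose F p : Cplx R := if p \in @toC R @^-1` O then f (toC p) else 0.
have mF : measurable_funC setT F.
  exact: (measurable_funC_restrict mO (measurable_funC_derivable oO df)).
pose sh n (p : R * R) : R * R := (n.+1%:R^-1 + p.1, p.2).
have msh n : measurable_fun setT (sh n).
  by apply: measurable_fun_pair => //; exact: measurable_funD.
have shE n p : toC (sh n p) = real_step n + toC p.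
  by apply/eqP; rewrite eq_complex/= add0r !eqxx.
pose q n p : Cplx R := (real_step n)^-1 * (F (sh n p) - F p).
have mq n : measurable_funC (@toC R @^-1` O) (q n).
  apply: (@measurable_funCS _ _ _ _ setT) => //.
  apply: measurable_funC_mul; first exact: measurable_funC_cst.
  apply: measurable_funCB => //; case: mF => mR mI; split.
    exact: (measurableT_comp mR (msh n)).
  exact: (measurableT_comp mI (msh n)).
apply: (measurable_real_cvg mq) => p Op.
have := derive1_seq (df _ Op) real_step_neq0 real_step_cvg.
apply: cvg_trans; apply: near_eq_cvg.
have Onear : \forall n \near \oo, O (real_step n + toC p).
  have /nbhs_Cplx[e e0 eO] : nbhs (toC p) O by exact: open_nbhs_nbhs.
  have : \forall n \near \oo, [set z : Cplx R | normc z < e] (real_step n).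
    apply: real_step_cvg; apply/nbhs_Cplx; exists e => // w /=.
    by rewrite sub0r normcN.
  apply: filterS => n /= H; apply: eO.
  by rewrite opprD addrC addrNK normcN.
apply: filterS Onear => n On; rewrite /q /F.
by rewrite !mem_set//= shE.
Qed.

End derivative.

(** * Integration on a Riemann surface *)

Lemma sigma_finite_product_measure d1 d2 (T1 : measurableType d1)
    (T2 : measurableType d2) (R : realType)
    (m1 : {sigma_finite_measure set T1 -> \bar R})
    (m2 : {sigma_finite_measure set T2 -> \bar R}) :
  sigma_finite setT (m1 \x m2)%E.
Proof.
have [F FT mF] := sigma_finiteT m1; have [G GT mG] := sigma_finiteT m2.
pose H n := if @unpickle (nat * nat)%type n is Some ij
  then F ij.1 `*` G ij.2 else set0.
exists H.
  apply/seteqP; split=> // -[x y] _.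
  have [i _ Fx] : (\bigcup_i F i) x by rewrite -FT.
  have [j _ Gy] : (\bigcup_i G i) y by rewrite -GT.
  by exists (pickle (i, j)) => //; rewrite /H pickleK.
move=> n; rewrite /H; case: unpickle => [[i j]|]; last by rewrite measure0.
have [mFi Fioo] := mF i; have [mGj Gjoo] := mG j.
split; first exact: measurableX.
by rewrite product_measure1E// lte_mul_pinfty// ge0_fin_numE.
Qed.

Section measures.
Context (R : realType).
Local Notation plane := (measurableTypeR R * measurableTypeR R)%type.

HB.instance Definition _ := @isSFinite.Build _ nat R (@counting nat R)
  (sfinite_measure_sigma_finite (sigma_finite_counting R)).

(* An alias is needed because the sigma-finite instance that the library
   declares for [\x] is shadowed by the one for subprobabilities. *)
Definition area : set plane -> \bar R :=
  (@lebesgue_measure R \x @lebesgue_measure R)%E.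

HB.instance Definition _ := Measure.on area.
HB.instance Definition _ := Measure_isSigmaFinite.Build _ plane R area
  (sigma_finite_product_measure _ _).

(* The pair [(n, p)] stands for the point of the surface with coordinate [p] in
   the [n]-th piece, so that [surface_integral] is an integral over one
   sigma-finite space. *)
Definition pieces_measure : set (nat * plane) -> \bar R :=
  (@counting nat R \x area)%E.

HB.instance Definition _ := Measure.on pieces_measure.
HB.instance Definition _ :=
  Measure_isSigmaFinite.Build _ (nat * plane)%type R pieces_measure
  (sigma_finite_product_measure _ _).

End measures.
Arguments area : clear implicits.
Arguments pieces_measure : clear implicits.

Section surface.
Context (R : realType) (X : riemannSurface R).
Implicit Types i j : chart_index X.

Definition overlap i j : set (Cplx R) := img i `&` unchart i @^-1` dom j.

Lemma overlap_open i j : open (overlap i j).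
Proof.
rewrite openE => z [iz jz].
apply: filterI; first by apply: open_nbhs_nbhs; split; [exact: img_open|].
have := @unchart_continuous _ X i.
rewrite (continuous_open_subspace _ (@img_open _ X i)).
move=> /(_ z (mem_set iz)); apply.
by apply: open_nbhs_nbhs; split; [exact: dom_open|].
Qed.

Lemma transition_derivable i j z : overlap i j z ->
  derivable (transition i j) z 1.
Proof.
move=> [iz jz]; have := transition_holomorphic (unchart_dom iz) jz.
by rewrite unchartK.
Qed.

Lemma charts_cover x : exists n, dom (charts X n) x.
Proof. by rewrite /charts; case: (cid _) => u. Qed.

(** Without the direct image, a piece is visibly a difference of open sets in the coordinate plane,
    hence Borel. *)
Lemma pieceE n : piece X n = @toC R @^-1`
  (img (charts X n) `\` \bigcup_(m in [set m | (m < n)%N])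
     overlap (charts X n) (charts X m)).
Proof.
rewrite /piece; congr (_ @^-1` _); apply/seteqP; split=> z.
  move=> [x [nx nU] <-]; split; first exact: chart_img.
  by move=> [m mn [_ /=]]; rewrite chartK// => mx; apply: nU; exists m.
move=> [nz nU]; exists (unchart (charts X n) z); last exact: unchartK.
split; first exact: unchart_dom.
by move=> [m mn mx]; apply: nU; exists m.
Qed.

Lemma piece_img n p : piece X n p -> img (charts X n) (toC p).
Proof. by rewrite pieceE => -[]. Qed.

Lemma measurable_piece n : measurable (piece X n).
Proof.
have -> : piece X n = @toC R @^-1` img (charts X n) `\`
    @toC R @^-1` (\bigcup_(m in [set m | (m < n)%N])
     overlap (charts X n) (charts X m)) by exact: pieceE.
apply: measurableD; first by apply: measurable_toC_open; exact: img_open.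
rewrite preimage_bigcup; apply: bigcup_measurable => m _.
by apply: measurable_toC_open; exact: overlap_open.
Qed.

Lemma measurable_fun_nat_prod d (T : measurableType d)
    d' (U : measurableType d') (H : nat * T -> U) :
  (forall n, measurable_fun setT (fun p => H (n, p))) -> measurable_fun setT H.
Proof.
move=> mH _ Y mY; rewrite setTI.
have -> : H @^-1` Y = \bigcup_n ([set n] `*` ((fun p => H (n, p)) @^-1` Y)).
  by apply/seteqP; split=> [[n p] /= HY|[n p] [k _ [/= -> //]]]; exists n.
apply: bigcup_measurable => n _; apply: measurableX => //.
by rewrite -[X in measurable X]setTI; exact: mH.
Qed.

(** The default [v0] fills the complement of the pieces, so that all integrals can run over the
    whole product space. *)
Definition on_pieces V (v0 : V) (h : chart_index X -> Cplx R -> V)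
  (t : nat * (measurableTypeR R * measurableTypeR R)) : V :=
  if (t.2 : R * R) \in piece X t.1 then h (charts X t.1) (toC t.2) else v0.

Variable h : chart_index X -> Cplx R -> R.

Hypothesis mh : forall n,
  measurable_fun (piece X n) (fun p => h (charts X n) (toC p)).

Lemma measurable_on_pieces : measurable_fun setT (on_pieces 0 h).
Proof.
apply: measurable_fun_nat_prod => n.
exact/(measurable_restrictT _ (measurable_piece n)).
Qed.

Lemma integral_on_piece n : (\int[area R]_p (on_pieces 0 h (n, p))%:E =
  \int[area R]_(p in piece X n) (h (charts X n) (toC p))%:E)%E.
Proof.
rewrite [RHS]integral_mkcond; apply: eq_integral => p _.
by rewrite patchE /on_pieces/=; case: ifP.
Qed.

Lemma surface_integral_ge0 : (forall i z, 0 <= h i z) ->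
  surface_integral h = (\int[pieces_measure R]_t (on_pieces 0 h t)%:E)%E.
Proof.
move=> h0; have H0 t : (0 <= (on_pieces 0 h t)%:E)%E.
  by rewrite lee_fin /on_pieces; case: ifP.
rewrite /pieces_measure fubini_tonelli1//; last first.
  by apply/measurable_EFinP; exact: measurable_on_pieces.
rewrite ge0_integral_count; last first.
  by move=> n; apply: integral_ge0 => p _; exact: H0.
by apply: eq_eseriesr => n _; rewrite -integral_on_piece.
Qed.

(** By Fubini the integrals over the slices are integrable for the counting measure; this is the
    summability that turns the outer integral into a series. *)
Lemma surface_integral_L1 : L1 (pieces_measure R) (on_pieces 0 h) ->
  surface_integral h = (\int[pieces_measure R]_t (on_pieces 0 h t)%:E)%E.
Proof.
move=> hi; rewrite -integral12_prod_meas1// integral_count.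
  by apply: eq_eseriesr => n _; rewrite -integral_on_piece.
have /integrableP[_] := integrable_fubini_F hi.
by rewrite ge0_integral_count// /summable nneseries_esumT.
Qed.

End surface.

(** * Measurability and norms of forms, read on the pieces *)

Section forms.
Context (R : realType) (X : riemannSurface R).
Implicit Types (mu nu phi : coefficients X) (c : Cplx R).
Local Notation normc := Normc.normc.
Local Notation m := (pieces_measure R).
Local Notation M := (on_pieces (0 : Cplx R)).

Lemma on_pieces_comp V W (v0 : V) (w0 : W) (f : V -> W)
    (h : chart_index X -> Cplx R -> V) t : f v0 = w0 ->
  on_pieces w0 (fun i z => f (h i z)) t = f (on_pieces v0 h t).
Proof. by move=> fv; rewrite /on_pieces; case: ifP. Qed.

Lemma on_pieces_mul (F : Cplx R -> R) mu phi t : F 0 = 0 ->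
  on_pieces 0 (fun i z => F (mu i z * phi i z)) t = F (M mu t * M phi t).
Proof.
by move=> F0; rewrite /on_pieces; case: ifP => // _; rewrite mul0r F0.
Qed.

Lemma measurable_on_piecesC mu :
  (forall n, measurable_funC (piece X n) (fun p => mu (charts X n) (toC p))) ->
  measurable_funC setT (M mu).
Proof.
move=> mm; split.
  rewrite (_ : (fun _ => _) = on_pieces 0 (fun i z => complex.Re (mu i z))).
    by apply: measurable_on_pieces => n; exact: (mm n).1.
  by apply/funext => t; rewrite (@on_pieces_comp _ _ 0).
rewrite (_ : (fun _ => _) = on_pieces 0 (fun i z => complex.Im (mu i z))).
  by apply: measurable_on_pieces => n; exact: (mm n).2.
by apply/funext => t; rewrite (@on_pieces_comp _ _ 0).
Qed.

Lemma measurable_img i : measurable (@toC R @^-1` img (r := X) i).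
Proof. by apply: measurable_toC_open; exact: img_open. Qed.

Lemma Linfty_measurable mu n : Linfty mu ->
  measurable_funC (piece X n) (fun p => mu (charts X n) (toC p)).
Proof.
move=> [_ mR mI _].
apply: (@measurable_funCS _ _ _ _ (@toC R @^-1` img (charts X n))).
- exact: measurable_img.
- by move=> p; exact: piece_img.
- by split; [exact: mR|exact: mI].
Qed.

Lemma holomorphic_measurable phi n :
  (forall i z, img i z -> derivable (phi i) z 1) ->
  measurable_funC (piece X n) (fun p => phi (charts X n) (toC p)).
Proof.
move=> dphi; apply: (@measurable_funCS _ _ _ _ (@toC R @^-1` img (charts X n))).
- exact: measurable_img.
- by move=> p; exact: piece_img.
- apply: measurable_funC_derivable; first exact: img_open.
  exact: dphi.
Qed.

Lemma A2_measurable phi n : A2 phi ->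
  measurable_funC (piece X n) (fun p => phi (charts X n) (toC p)).
Proof. by move=> [_ dphi _]; exact: holomorphic_measurable. Qed.

Lemma measurable_Linfty mu : Linfty mu -> measurable_funC setT (M mu).
Proof.
by move=> Lmu; apply: measurable_on_piecesC => n; exact: Linfty_measurable.
Qed.

Lemma norm1E phi :
  (forall n, measurable_funC (piece X n) (fun p => phi (charts X n) (toC p))) ->
  norm1 phi = (\int[m]_t (normc (M phi t))%:E)%E.
Proof.
move=> mphi; rewrite /norm1 surface_integral_ge0.
- by apply: eq_integral => t _; rewrite (@on_pieces_comp _ _ 0)// Normc.normc0.
- by move=> n; exact: measurable_normc.
- by move=> i z; exact: normc_ge0.
Qed.

Lemma norm1_ltyP phi :
  (forall n, measurable_funC (piece X n) (fun p => phi (charts X n) (toC p))) ->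
  (norm1 phi < +oo)%E <-> L1c m (M phi).
Proof.
move=> mphi; have mM := measurable_on_piecesC mphi; rewrite norm1E//; split.
  move=> fin; apply: L1c_of_norm => //; apply/integrableP; split.
    by apply/measurable_EFinP; exact: measurable_normc.
  under eq_integral do rewrite gee0_abs ?lee_fin ?normc_ge0//.
  exact: fin.
move=> /L1c_norm/integrableP[_].
by under eq_integral do rewrite gee0_abs ?lee_fin ?normc_ge0//.
Qed.

Lemma A2_L1c phi : A2 phi -> L1c m (M phi).
Proof.
by move=> Aphi; apply/norm1_ltyP; [move=> n; exact: A2_measurable|case: Aphi].
Qed.

Lemma norm1_Rintegral phi : A2 phi ->
  norm1 phi = (\int[m]_t normc (M phi t))%:E.
Proof.
move=> Aphi; rewrite norm1E; last by move=> n; exact: A2_measurable.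
rewrite /Rintegral fineK//; apply: integrable_fin_num => //.
exact: (L1c_norm (A2_L1c Aphi)).
Qed.

(** For the zero measure essential suprema degenerate to minus infinity; positive total mass is what
    makes [essnorm] nonnegative. *)
Lemma area_setT_gt0 :
  (0 < (@lebesgue_measure R \x @lebesgue_measure R)%E setT)%E.
Proof.
rewrite -setXTT product_measure1E//.
have T0 : (0 < @lebesgue_measure R setT)%E.
  apply: (@lt_le_trans _ _ (lebesgue_measure `[0%R, 1%R]%classic)).
    by rewrite lebesgue_measure_itv/= lte_fin ltr01 oppr0 adde0 lte_fin.
  by apply: le_measure => //; rewrite inE.
exact: mule_gt0.
Qed.

Lemma ess_sup_essnorm mu i :
  (ess_sup (@lebesgue_measure R \x @lebesgue_measure R)%E
    ((fun p => (normc (mu i (toC p)))%:E) \_ (@toC R @^-1` img i)) <=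
  essnorm mu)%E.
Proof. by apply: ereal_sup_ubound; exists i. Qed.

Lemma essnorm_ge0 mu : (0 <= essnorm mu)%E.
Proof.
apply: le_trans (ess_sup_essnorm mu (charts X 0)).
apply: ess_sup_gee; first exact: area_setT_gt0.
apply: aeW => p; rewrite patchE; case: ifP => // _.
by rewrite lee_fin normc_ge0.
Qed.

Lemma supnorm_ge0 mu : 0 <= supnorm mu.
Proof. exact/fine_ge0/essnorm_ge0. Qed.

Lemma essnormE mu : Linfty mu -> essnorm mu = (supnorm mu)%:E.
Proof.
move=> [_ _ _ fin]; rewrite /supnorm fineK// ge0_fin_numE//.
exact: essnorm_ge0.
Qed.

Lemma essnorm_le mu (s : R) : 0 <= s ->
  (forall i z, img i z -> normc (mu i z) <= s) -> (essnorm mu <= s%:E)%E.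
Proof.
move=> s0 mus; apply: ge_ereal_sup => _ [i _ <-].
apply/ess_supP; apply: aeW => p.
rewrite patchE; case: ifP => [|_]; rewrite lee_fin//.
by rewrite inE => /mus.
Qed.

Lemma supnorm_le mu (s : R) : 0 <= s ->
  (forall i z, img i z -> normc (mu i z) <= s) -> supnorm mu <= s.
Proof.
move=> s0 mus; have := essnorm_le s0 mus; have := essnorm_ge0 mu.
by rewrite /supnorm; case: (essnorm mu).
Qed.

Lemma essnormB mu nu : (essnorm (mu - nu)%R <= essnorm mu + essnorm nu)%E.
Proof.
apply: ge_ereal_sup => _ [i _ <-].
apply: le_trans (leeD (ess_sup_essnorm mu i) (ess_sup_essnorm nu i)).
apply: le_trans (ess_supD _ _ _); apply: le_ess_sup; apply: aeW => p.
rewrite !patchE; case: ifP => _; last by rewrite adde0.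
rewrite -EFinD lee_fin -[(mu - nu) i (toC p)]/(mu i (toC p) - nu i (toC p)).
by rewrite -(normcN (nu i (toC p))); exact: le_normcD.
Qed.

Lemma LinftyB mu nu : Linfty mu -> Linfty nu -> Linfty (mu - nu).
Proof.
move=> Lmu Lnu; have := essnormB mu nu.
rewrite (essnormE Lmu) (essnormE Lnu) => le.
have [bmu mR mI _] := Lmu; have [bnu nR nI _] := Lnu; split.
- move=> i j x ix jx z dT; rewrite -[(mu - nu) i z]/(mu i z - nu i z).
  rewrite -[(mu - nu) j _]/(mu j (transition i j z) - nu j (transition i j z)).
  by rewrite !mulrBl; congr (_ - _); [exact: bmu|exact: bnu].
- move=> i; rewrite (_ : (fun _ => _) =
    fun p => complex.Re (mu i (toC p)) - complex.Re (nu i (toC p))).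
    by apply: measurable_funB; [exact: mR|exact: nR].
  apply/funext => p; rewrite -[(mu - nu) i _]/(mu i _ - nu i _).
  by case: (mu i _) (nu i _) => ? ? [].
- move=> i; rewrite (_ : (fun _ => _) =
    fun p => complex.Im (mu i (toC p)) - complex.Im (nu i (toC p))).
    by apply: measurable_funB; [exact: mI|exact: nI].
  apply/funext => p; rewrite -[(mu - nu) i _]/(mu i _ - nu i _).
  by case: (mu i _) (nu i _) => ? ? [].
- by apply: le_lt_trans le _; rewrite -EFinD ltry.
Qed.

(** The exceptional set is null because each slice is: slice [n] lies in the exceptional null set of
    the single chart [charts X n], whose essential supremum is at most [essnorm mu]. *)
Lemma ae_supnorm mu : Linfty mu ->
  {ae m, forall t, normc (M mu t) <= supnorm mu}.
Proof.
move=> Lmu; have mN := measurable_normc (measurable_Linfty Lmu).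
pose E := [set t | supnorm mu < normc (M mu t)].
have mE : measurable E.
  by rewrite -[E]setTI; exact: measurable_fun_ltr.
exists E; split=> //; last by move=> t /= /negP; rewrite -ltNge.
rewrite /pieces_measure /product_measure1; apply: integral0_eq => n _ /=.
have /ess_supP[N [mN' N0 subN]] := ess_sup_essnorm mu (charts X n).
apply: (subset_measure0 _ mN' _ N0); first exact: measurable_xsection.
move=> p /xsectionP; rewrite /E /= => lt; apply: subN => /=.
rewrite essnormE// patchE; move: lt; rewrite /on_pieces/=.
have [|_] := boolP (p \in piece X n); last first.
  by rewrite Normc.normc0 ltNge supnorm_ge0.
by rewrite inE => /piece_img ip; rewrite mem_set//= lee_fin leNgt => ->.
Qed.

End forms.

(** * Integrals of complex-valued functions *)

Section complex_integral.
Context d (T : measurableType d) (R : realType).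
Variable mu : {sigma_finite_measure set T -> \bar R}.
Implicit Types (F G : T -> R[i]) (c : R[i]).
Local Notation normc := Normc.normc.

Definition Cintegral F : R[i] :=
  ((\int[mu]_x complex.Re (F x)) +i* (\int[mu]_x complex.Im (F x)))%C.

Lemma L1_ae_eq (f g : T -> R) : measurable_fun setT f -> L1 mu g ->
  {ae mu, forall x, f x = g x} -> L1 mu f.
Proof.
move=> mf gi fg; apply/integrableP; split; first exact/measurable_EFinP.
have /integrableP[mg] := gi; apply: le_lt_trans.
rewrite (@ae_eq_integral _ _ _ mu setT (abse \o (EFin \o g)))//.
- by apply: measurableT_comp => //; exact/measurable_EFinP.
- exact: measurableT_comp.
- by apply: filterS fg => x /= -> _.
Qed.

Lemma L1c_ae_eq F G : measurable_funC setT F -> L1c mu G ->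
  {ae mu, forall x, F x = G x} -> L1c mu F.
Proof.
move=> [mR mI] [GR GI] FG.
by split; [apply: L1_ae_eq mR GR _|apply: L1_ae_eq mI GI _];
  apply: filterS FG => x ->.
Qed.

Lemma eq_Rintegral_ae (f g : T -> R) : measurable_fun setT f ->
  measurable_fun setT g -> {ae mu, forall x, f x = g x} ->
  \int[mu]_x f x = \int[mu]_x g x.
Proof.
move=> mf mg fg; congr fine; apply: ae_eq_integral => //.
- exact/measurable_EFinP.
- exact/measurable_EFinP.
- by apply: filterS fg => x -> _.
Qed.

Lemma CintegralB F G : L1c mu F -> L1c mu G ->
  Cintegral (fun x => F x - G x) = Cintegral F - Cintegral G.
Proof.
move=> [FR FI] [GR GI]; rewrite /Cintegral.
apply/eqP; rewrite eq_complex; apply/andP; split; apply/eqP.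
  rewrite -[RHS]RintegralB//; apply: eq_Rintegral => x _.
  by case: (F x) (G x) => a b [].
rewrite -[RHS]RintegralB//; apply: eq_Rintegral => x _.
by case: (F x) (G x) => a b [].
Qed.

Lemma L1cZ c F : L1c mu F -> L1c mu (fun x => c * F x).
Proof.
by move=> iF; apply: (@L1c_mul _ _ _ mu (normc c)).
Qed.

Lemma CintegralZ c F : L1c mu F ->
  Cintegral (fun x => c * F x) = c * Cintegral F.
Proof.
case: c => a b [FR FI]; rewrite /Cintegral.
apply/eqP; rewrite eq_complex; apply/andP; split; apply/eqP => /=.
  rewrite -!RintegralZl// -RintegralB//; [|exact: L1Z|exact: L1Z].
  by apply: eq_Rintegral => x _; case: (F x).
rewrite -!RintegralZl// -RintegralD//; [|exact: L1Z|exact: L1Z].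
by apply: eq_Rintegral => x _; case: (F x).
Qed.

Lemma Re_Cintegral_le F : L1c mu F ->
  complex.Re (Cintegral F) <= \int[mu]_x normc (F x).
Proof.
move=> iF; apply: le_Rintegral => //; [exact: iF.1|exact: L1c_norm|].
by move=> x _; apply: le_trans (ler_norm _) (normc_ge_abs_Re _).
Qed.

(* Rotating the integral onto the positive real axis reduces the estimate to
   that of its real part. *)
Lemma normc_Cintegral_le F : L1c mu F ->
  normc (Cintegral F) <= \int[mu]_x normc (F x).
Proof.
move=> iF; set z := Cintegral F.
have [->|z0] := eqVneq (normc z) 0.
  by apply: Rintegral_ge0 => x _; exact: normc_ge0.
pose u : R[i] := ((normc z)^-1)%:C%C * (z^*)%C.
have nu : normc u = 1.
  rewrite Normc.normcM normc_conj normc_real ger0_norm ?invr_ge0 ?normc_ge0//.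
  by rewrite mulVf.
have -> : normc z = complex.Re (Cintegral (fun x => u * F x)).
  rewrite CintegralZ// -/z /u -mulrA [(z^*)%C * z]mulrC mul_conjc -rmorphM.
  by rewrite expr2 mulKf.
apply: le_trans (Re_Cintegral_le (L1cZ u iF)) _.
by under eq_Rintegral do rewrite Normc.normcM nu mul1r.
Qed.

End complex_integral.

#[local] Instance ae_pieces_measure_filter (R : realType) :
  Filter (almost_everywhere (pieces_measure R)).
Proof.
exact: (@ae_filter_ringOfSetsType _ _ R
  (pieces_measure R : {sigma_finite_measure set _ -> \bar R})).
Qed.

(** * The pairing as an integral over the pieces *)

Section pairing.
Context (R : realType) (X : riemannSurface R).
Implicit Types (mu nu phi psi : coefficients X) (c : Cplx R).
Local Notation normc := Normc.normc.
Local Notation m := (pieces_measure R).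
Local Notation M := (on_pieces (0 : Cplx R)).

(** Setting the coefficient to 0 on the null set where it exceeds its norm gives the pointwise bound
    that [L1c_mul] asks for. *)
Lemma Linfty_bounded_version mu : Linfty mu ->
  exists G : nat * (measurableTypeR R * measurableTypeR R) -> R[i],
    [/\ measurable_funC setT G,
    forall t, normc (G t) <= supnorm mu & {ae m, forall t, M mu t = G t}].
Proof.
move=> Lmu; have mM := measurable_Linfty Lmu; have mN := measurable_normc mM.
pose A := [set t | normc (M mu t) <= supnorm mu].
have mA : measurable A by rewrite -[A]setTI; exact: measurable_fun_ler.
exists (fun t => if t \in A then M mu t else 0); split.
- by apply: (measurable_funC_restrict mA); exact: (measurable_funCS _ _ mM).
- move=> t; case: ifPn; first by rewrite inE.
  by rewrite Normc.normc0 supnorm_ge0.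
- by apply: filterS (ae_supnorm Lmu) => t tA; rewrite mem_set.
Qed.

Lemma L1c_Linfty_mul mu F : Linfty mu -> L1c m F ->
  L1c m (fun t => M mu t * F t).
Proof.
move=> Lmu iF; have [G [mG Gs MG]] := Linfty_bounded_version Lmu.
apply: (L1c_ae_eq _ (L1c_mul mG Gs iF)).
  exact: measurable_funC_mul (measurable_Linfty Lmu) (L1c_measurable iF).
by apply: filterS MG => t ->.
Qed.

Lemma Rintegral_normc_mul_le mu F : Linfty mu -> L1c m F ->
  \int[m]_t normc (M mu t * F t) <= supnorm mu * \int[m]_t normc (F t).
Proof.
move=> Lmu iF; have [G [mG Gs MG]] := Linfty_bounded_version Lmu.
have iGF := L1c_mul mG Gs iF; have iMF := L1c_Linfty_mul Lmu iF.
rewrite (@eq_Rintegral_ae _ _ _ m _ (fun t => normc (G t * F t))).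
- rewrite -RintegralZl//; last exact: L1c_norm.
  apply: le_Rintegral => //; first exact: L1c_norm.
    by apply: L1Z; exact: L1c_norm.
  by move=> t _; rewrite Normc.normcM ler_wpM2r ?normc_ge0.
- exact/measurable_normc/L1c_measurable/iMF.
- exact/measurable_normc/L1c_measurable/iGF.
- by apply: filterS MG => t ->.
Qed.

Lemma pairingE mu phi : Linfty mu -> A2 phi ->
  pairing mu phi = Cintegral m (fun t => M mu t * M phi t).
Proof.
move=> Lmu Aphi; have [iR iI] := L1c_Linfty_mul Lmu (A2_L1c Aphi).
have mp n : measurable_funC (piece X n)
    (fun p => mu (charts X n) (toC p) * phi (charts X n) (toC p)).
  apply: measurable_funC_mul; first exact: Linfty_measurable.
  exact: A2_measurable.
have eqR : on_pieces 0 (fun i z => complex.Re (mu i z * phi i z)) =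
    fun t => complex.Re (M mu t * M phi t).
  by apply/funext => t; rewrite (on_pieces_mul (F := @complex.Re R)).
have eqI : on_pieces 0 (fun i z => complex.Im (mu i z * phi i z)) =
    fun t => complex.Im (M mu t * M phi t).
  by apply/funext => t; rewrite (on_pieces_mul (F := @complex.Im R)).
have mpR n := (mp n).1; have mpI n := (mp n).2.
by rewrite /pairing !surface_integral_L1 ?eqR ?eqI.
Qed.

Lemma pairingB mu nu phi : Linfty mu -> Linfty nu -> A2 phi ->
  pairing (mu - nu) phi = pairing mu phi - pairing nu phi.
Proof.
move=> Lmu Lnu Aphi; rewrite !pairingE//; last exact: LinftyB.
have iphi := A2_L1c Aphi.
rewrite -CintegralB; [|exact: L1c_Linfty_mul|exact: L1c_Linfty_mul].
congr Cintegral; apply/funext => t.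
rewrite -mulrBl; congr (_ * _); rewrite /on_pieces; case: ifP => // _.
by rewrite subr0.
Qed.

Lemma normc_pairing_le mu phi : Linfty mu -> A2 phi ->
  normc (pairing mu phi) <= supnorm mu * \int[m]_t normc (M phi t).
Proof.
move=> Lmu Aphi; rewrite pairingE//; have iphi := A2_L1c Aphi.
apply: le_trans (normc_Cintegral_le (L1c_Linfty_mul Lmu iphi)) _.
exact: Rintegral_normc_mul_le.
Qed.

Definition formZD c phi psi : coefficients X :=
  fun i z => c * phi i z + psi i z.

Lemma on_pieces_formZD c phi psi t :
  M (formZD c phi psi) t = c * M phi t + M psi t.
Proof. by rewrite /on_pieces; case: ifP => // _; rewrite mulr0 addr0. Qed.

End pairing.

(** * The norm of a Beltrami form as a functional on [A2] *)

Section A2_space.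
Context (R : realType) (X : riemannSurface R).
Implicit Types (mu nu phi psi : coefficients X) (c : Cplx R).
Local Notation normc := Normc.normc.
Local Notation m := (pieces_measure R).
Local Notation M := (on_pieces (0 : Cplx R)).

Definition form0 : coefficients X := fun _ _ => 0.

Lemma on_pieces_form0 t : M form0 t = 0.
Proof. by rewrite /on_pieces; case: ifP. Qed.

Lemma A2_form0 : A2 form0.
Proof.
have d0 i z : img i z -> derivable (form0 i) z 1.
  by move=> _; exact: derivable_cst.
split => //; first by move=> i j x _ _; exact: mul0r.
apply/norm1_ltyP; first by move=> n; exact: holomorphic_measurable.
rewrite (_ : M form0 = fun=> 0); last first.
  by apply/funext => t; exact: on_pieces_form0.
by split; exact: L1_0.
Qed.

Lemma A2_formZD c phi psi : A2 phi -> A2 psi -> A2 (formZD c phi psi).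
Proof.
move=> Aphi Apsi; have [qphi dphi _] := Aphi; have [qpsi dpsi _] := Apsi.
have d i z : img i z -> derivable (formZD c phi psi i) z 1.
  by move=> iz; exact: derivable1_linear (dphi _ _ iz) (dpsi _ _ iz).
split => //.
  move=> i j x ix jx z dT.
  rewrite /formZD mulrDl -mulrA; congr (_ * _ + _); [exact: qphi|exact: qpsi].
apply/norm1_ltyP; first by move=> n; exact: holomorphic_measurable.
rewrite (_ : M _ = (fun t => c * M phi t : Rcomplex R) + M psi).
  apply: (subspace_setD (L1c_subspace m)); last exact: A2_L1c.
  by apply: L1cZ; exact: A2_L1c.
by apply/funext => t; rewrite on_pieces_formZD.
Qed.

Lemma A2_scale c phi : A2 phi -> A2 (formZD c phi form0).
Proof. by move=> Aphi; exact: A2_formZD Aphi A2_form0. Qed.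

Lemma pairing_scale mu c phi : Linfty mu -> A2 phi ->
  pairing mu (formZD c phi form0) = c * pairing mu phi.
Proof.
move=> Lmu Aphi; rewrite (pairingE Lmu (A2_scale c Aphi)) (pairingE Lmu Aphi).
rewrite -CintegralZ; last exact: L1c_Linfty_mul Lmu (A2_L1c Aphi).
congr Cintegral; apply/funext => t.
by rewrite on_pieces_formZD on_pieces_form0 addr0 mulrCA.
Qed.

Lemma Rintegral_scale c phi :
  A2 phi -> \int[m]_t normc (M (formZD c phi form0) t) =
  normc c * \int[m]_t normc (M phi t).
Proof.
move=> Aphi; rewrite -RintegralZl//; last exact/L1c_norm/A2_L1c.
apply: eq_Rintegral => t _.
by rewrite on_pieces_formZD on_pieces_form0 addr0 Normc.normcM.
Qed.

(** This is the left-hand side of [hamilton]. The unit ball contains the zero form, so this supremum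
    is never an empty one. *)
Definition pairing_norm mu : R := sup [set normc (pairing mu phi) |
  phi in [set phi | A2 phi /\ (norm1 phi <= 1)%E]].

Section pairing_norm.
Variable mu : coefficients X.
Hypothesis Lmu : Linfty mu.

Lemma pairing_norm_set0 : [set normc (pairing mu phi) |
  phi in [set phi | A2 phi /\ (norm1 phi <= 1)%E]] !=set0.
Proof.
exists (normc (pairing mu form0)); exists form0 => //.
split; first exact: A2_form0.
rewrite norm1_Rintegral ?lee_fin; last exact: A2_form0.
under eq_Rintegral do rewrite on_pieces_form0 Normc.normc0.
by rewrite Rintegral_cst// mul0r.
Qed.

Lemma pairing_norm_ubound : ubound [set normc (pairing mu phi) |
  phi in [set phi | A2 phi /\ (norm1 phi <= 1)%E]] (supnorm mu).
Proof.
move=> _ [phi [Aphi n1] <-]; apply: le_trans (normc_pairing_le Lmu Aphi) _.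
rewrite norm1_Rintegral// lee_fin in n1.
by rewrite -[leRHS]mulr1 ler_wpM2l// supnorm_ge0.
Qed.

Lemma pairing_norm_le : pairing_norm mu <= supnorm mu.
Proof.
by apply: sup_le_ub; [exact: pairing_norm_set0|exact: pairing_norm_ubound].
Qed.

Lemma normc_pairing_le_norm phi : A2 phi -> (norm1 phi <= 1)%E ->
  normc (pairing mu phi) <= pairing_norm mu.
Proof.
move=> Aphi n1; apply: ub_le_sup; last by exists phi.
by exists (supnorm mu); exact: pairing_norm_ubound.
Qed.

Lemma pairing_norm_ge0 : 0 <= pairing_norm mu.
Proof.
have [x [phi [Aphi n1] _]] := pairing_norm_set0.
exact: le_trans (normc_ge0 _) (normc_pairing_le_norm Aphi n1).
Qed.

Lemma A2_normalize phi : A2 phi -> 0 < \int[m]_t normc (M phi t) ->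
  let psi := formZD ((\int[m]_t normc (M phi t))^-1)%:C%C phi form0 in
  [/\ A2 psi, norm1 psi = 1%E &
    normc (pairing mu phi) =
      \int[m]_t normc (M phi t) * normc (pairing mu psi)].
Proof.
move=> Aphi n0 psi; have Apsi : A2 psi by exact: A2_scale.
split => //.
  rewrite norm1_Rintegral// Rintegral_scale// normc_real.
  rewrite ger0_norm ?invr_ge0 ?ltW//.
  by rewrite mulVf// gt_eqF.
rewrite pairing_scale// Normc.normcM normc_real ger0_norm ?invr_ge0 ?ltW//.
by rewrite mulrA divff ?mul1r// gt_eqF.
Qed.

(** This covers the forms of norm 0, which cannot be normalised. *)
Lemma pairing_eq0 phi : A2 phi -> \int[m]_t normc (M phi t) <= 0 ->
  pairing mu phi = 0.
Proof.
move=> Aphi n0; apply: Normc.eq0_normc; apply/eqP.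
rewrite eq_le normc_ge0 andbT.
apply: le_trans (normc_pairing_le Lmu Aphi) _.
by rewrite mulr_ge0_le0// supnorm_ge0.
Qed.

Lemma normc_pairing_le_mul phi : A2 phi ->
  normc (pairing mu phi) <= pairing_norm mu * \int[m]_t normc (M phi t).
Proof.
move=> Aphi; have [n0|n0] := leP (\int[m]_t normc (M phi t)) 0.
  rewrite pairing_eq0// Normc.normc0 mulr_ge0 ?pairing_norm_ge0//.
  by apply: Rintegral_ge0 => t _; exact: normc_ge0.
have [Apsi n1 ->] := A2_normalize Aphi n0.
by rewrite mulrC ler_wpM2r ?(ltW n0)// normc_pairing_le_norm// n1.
Qed.

(** The summand [Re (pairing mu phi0)] is constant and leaves the supremum. What remains compares
    sphere and ball: normalising a form of the ball with positive norm does not decrease its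
    pairing, and a form of norm 0 pairs to 0. *)
Lemma beta_pairing_norm phi0 : A2 phi0 ->
  beta mu phi0 = pairing_norm mu + complex.Re (pairing mu phi0).
Proof.
move=> A0; set r := complex.Re _; rewrite /beta -/r.
set S := [set _ | _ in _].
have [[phi1 [Aphi1 n1]]|none] :=
  pselect (exists phi, A2 phi /\ norm1 phi = 1%E).
  have S0 : S !=set0 by exists (normc (pairing mu phi1) + r); exists phi1.
  have ubS : ubound S (pairing_norm mu + r).
    by move=> _ [phi [Aphi n] <-]; rewrite lerD2r normc_pairing_le_norm// n.
  apply/eqP; rewrite eq_le; apply/andP; split; first exact: sup_le_ub.
  rewrite -lerBrDr; apply: sup_le_ub; first exact: pairing_norm_set0.
  have leS phi : A2 phi -> norm1 phi = 1%E ->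
      normc (pairing mu phi) <= sup S - r.
    move=> Aphi n; rewrite lerBrDr; apply: ub_le_sup; last by exists phi.
    by exists (pairing_norm mu + r).
  move=> _ [phi [Aphi nphi] <-].
  have [n0|n0] := leP (\int[m]_t normc (M phi t)) 0.
    rewrite pairing_eq0// Normc.normc0.
    exact: le_trans (normc_ge0 _) (leS _ Aphi1 n1).
  have [Apsi npsi ->] := A2_normalize Aphi n0.
  apply: le_trans (leS _ Apsi npsi).
  rewrite -[leRHS]mul1r ler_wpM2r ?normc_ge0//.
  by rewrite -lee_fin -norm1_Rintegral.
(* With an empty sphere no form has positive norm, so the pairing with [phi0] vanishes too and both
   sides are 0. *)
have p0 phi : A2 phi -> pairing mu phi = 0.
  move=> Aphi; apply: pairing_eq0 => //; rewrite leNgt; apply/negP => n0.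
  have [Apsi npsi _] := A2_normalize Aphi n0; apply: none.
  by eexists; split; [exact: Apsi|exact: npsi].
rewrite /r p0// addr0 (_ : S = set0) ?sup0; last first.
  by apply/seteqP; split => // t [phi Aphi _]; apply: none; exists phi.
apply/eqP; rewrite eq_le pairing_norm_ge0/=.
apply: sup_le_ub; first exact: pairing_norm_set0.
by move=> _ [phi [Aphi _] <-]; rewrite p0// Normc.normc0.
Qed.

End pairing_norm.
End A2_space.

(** * Beltrami forms with prescribed values on the pieces *)

Section extend_form.
Context (R : realType) (X : riemannSurface R).
Implicit Types (x : X) (i j : chart_index X).
Local Notation normc := Normc.normc.
Local Notation plane := (measurableTypeR R * measurableTypeR R)%type.
Local Notation M := (on_pieces (0 : Cplx R)).

(** This is the cocycle rule for conj a / a: transporting through two charts in turn is transporting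
    by the product of the derivatives. *)
Lemma conjc_quotientM (G a b : R[i]) :
  G * (a^*)%C / a * (b^*)%C / b = G * ((a * b)^*)%C / (a * b).
Proof. by rewrite rmorphM invfM; ring. Qed.

Lemma normc_conjc_quotient (G a : R[i]) : normc (G * (a^*)%C / a) <= normc G.
Proof.
rewrite !Normc.normcM Normc.normcV normc_conj -mulrA.
have [->|a0] := eqVneq (normc a) 0; first by rewrite mul0r mulr0 normc_ge0.
by rewrite divff// mulr1.
Qed.

Lemma first_chart_exists x : exists n, dom (charts X n) x /\
  forall k, (k < n)%N -> ~ dom (charts X k) x.
Proof.
have ex : exists n, `[< dom (charts X n) x >].
  by have [n nx] := charts_cover x; exists n; exact/asboolP.
exists (ex_minn ex); case: ex_minnP => n /asboolP nx min; split => // k kn kx.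
by have := min k (introT (asboolP _) kx); rewrite leqNgt kn.
Qed.

(** This is the index of the piece to which the point belongs. *)
Definition first_chart x : nat := projT1 (cid (first_chart_exists x)).

Lemma first_chart_dom x : dom (charts X (first_chart x)) x.
Proof. by rewrite /first_chart; case: cid => n []. Qed.

Lemma first_chart_min x k : (k < first_chart x)%N -> ~ dom (charts X k) x.
Proof. by rewrite /first_chart; case: cid => n [/= _]; apply. Qed.

Lemma first_chart_eq x n : dom (charts X n) x ->
  (forall k, (k < n)%N -> ~ dom (charts X k) x) -> first_chart x = n.
Proof.
move=> nx min; apply/eqP; rewrite eqn_leq.
apply/andP; split; rewrite leqNgt; apply/negP.
  by move=> /first_chart_min.
by move=> /min; apply; exact: first_chart_dom.
Qed.

Lemma piece_first_chart n p : piece X n p ->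
  first_chart (unchart (charts X n) (toC p)) = n.
Proof.
rewrite pieceE => -[ip nU]; apply: first_chart_eq; first exact: unchart_dom.
by move=> k kn kx; apply: nU; exists k.
Qed.

Variable g : nat * plane -> R[i].

(* The transformation rule of Beltrami forms transports the values of [g] from
   the piece that contains the point to all other charts.  As [|conj a / a| <= 1]
   for all [a], including [a = 0], a pointwise bound on [g] is preserved, and no
   null set has to be followed through a change of charts. *)
Definition extend_form : coefficients X := fun i z =>
  let n := first_chart (unchart i z) in
  let T := transition i (charts X n) in
  (g (n, ofC (T z)) : Cplx R) * ((derive1 T z)^*)%C / derive1 T z.

Lemma derive1_transition_id i (z : Cplx R) : img i z ->
  derive1 (transition i i) z = 1.
Proof.
move=> iz; rewrite -[RHS](derive1_idfun z); apply: near_eq_derive1.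
have : \forall w \near z, img i w.
  by apply: open_nbhs_nbhs; split => //; exact: img_open.
by apply: filterS => w iw; rewrite /transition/= unchartK.
Qed.

(** A point of the [n]-th piece has first chart [n], so its transport uses a transition that is the
    identity near the point, with derivative 1. *)
Lemma extend_form_piece n p : piece X n p ->
  extend_form (charts X n) (toC p) = g (n, p).
Proof.
move=> np; have ip := piece_img np.
rewrite /extend_form piece_first_chart// derive1_transition_id//.
have -> : ((1 : Cplx R)^*)%C = 1 by exact: conjc1.
by rewrite /transition/= unchartK// mulr1 divr1 toCK.
Qed.

(** The values in both charts come from the same piece, since the first chart depends on the point
    alone. Near [z] the transition from [i] to that piece factors through [j], and the chain rule
    reduces the claim to [conjc_quotientM]. *)
Lemma extend_form_beltrami : beltrami_form extend_form.
Proof.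
move=> i j x ix jx z dT.
have xz : unchart i z = x by exact: chartK.
have xw : unchart j (transition i j z) = x by rewrite /transition/= xz chartK.
rewrite /extend_form xw xz; set n := first_chart x.
have nx := first_chart_dom x; rewrite -/n in nx.
have Tc : transition j (charts X n) (transition i j z) =
    transition i (charts X n) z.
  by rewrite {1}/transition/= xw /transition/= xz.
have izo : overlap i j z by split; [exact: chart_img|rewrite /= xz].
have jwo : overlap j (charts X n) (transition i j z).
  by split; [rewrite /transition/= xz; exact: chart_img|rewrite /= xw].
have chain : derive1 (transition i (charts X n)) z =
    derive1 (transition j (charts X n)) (transition i j z) * dT.
  rewrite -(derive1_comp_numField (transition_derivable izo)
    (transition_derivable jwo)).
  apply: near_eq_derive1.
  have : \forall w \near z, overlap i j w.
    by apply: open_nbhs_nbhs; split => //; exact: overlap_open.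
  by apply: filterS => w [iw jw]; rewrite /transition/= chartK.
rewrite Tc chain; exact: conjc_quotientM.
Qed.

Lemma normc_extend_form (s : R) i z : (forall t, normc (g t) <= s) ->
  normc (extend_form i z) <= s.
Proof.
by move=> gs; exact: le_trans (normc_conjc_quotient _ _) (gs _).
Qed.

End extend_form.

Section extend_form_Linfty.
Context (R : realType) (X : riemannSurface R).
Implicit Types (x : X) (i j : chart_index X).
Local Notation normc := Normc.normc.
Local Notation plane := (measurableTypeR R * measurableTypeR R)%type.
Variable g : nat * plane -> R[i].
Hypothesis mg : measurable_funC setT g.

(** [g] is Borel and the transition is continuous on the overlap; extending the transition by 0
    gives a Borel map of the whole plane to compose with. *)
Lemma measurable_funC_transition n i j :
  measurable_funC (@toC R @^-1` overlap i j)
    (fun p => g (n, ofC (transition i j (toC p)))).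
Proof.
set O := @toC R @^-1` overlap i j.
have mO : measurable O by apply: measurable_toC_open; exact: overlap_open.
have mT : measurable_funC O (fun p => transition i j (toC p)).
  apply: (@measurable_funC_derivable R (transition i j)).
    exact: overlap_open.
  exact: transition_derivable.
have [mR mI] := measurable_funC_restrict mO mT.
pose q (p : R * R) : nat * plane :=
  (n, ofC (if p \in O then transition i j (toC p) else 0)).
have mq : measurable_fun setT q.
  apply: measurable_fun_pair; first exact: measurable_cst.
  by apply: measurable_fun_pair; [exact: mR|exact: mI].
apply: (@eq_measurable_funC _ _ _ _ (fun p => g (q p))).
  by move=> p pO; rewrite /q pO.
apply: (@measurable_funCS _ _ _ _ setT) => //; split.
  exact: (measurableT_comp mg.1 mq).
exact: (measurableT_comp mg.2 mq).
Qed.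

(** The index of the first chart varies with the point, but it is constant on each of countably many
    Borel sets [A n] that cover the image of chart [i]. *)
Lemma measurable_extend_form i :
  measurable_funC (@toC R @^-1` img i) (fun p => extend_form g i (toC p)).
Proof.
pose O n := @toC R @^-1` overlap i (charts X n).
have mO n : measurable (O n) by apply: measurable_toC_open; exact: overlap_open.
pose A n := O n `\` \bigcup_(k in `I_n) O k.
have mA n : measurable (A n).
  by apply: measurableD => //; exact: bigcup_measurable.
have UA : @toC R @^-1` img i = \bigcup_n A n.
  apply/seteqP; split=> [p ip|p [n _ [[] //]]].
  exists (first_chart (unchart i (toC p))) => //; split.
    by split => //; exact: first_chart_dom.
  by move=> [k /= kn [_ kx]]; exact: first_chart_min kn kx.
have AE n p : A n p -> first_chart (unchart i (toC p)) = n.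
  move=> [[ip nx] nU]; apply: first_chart_eq => // k kn kx.
  by apply: nU; exists k.
have mf n : measurable_funC (A n) (fun p => extend_form g i (toC p)).
  pose f p : R[i] := g (n, ofC (transition i (charts X n) (toC p))) *
    ((derive1 (transition i (charts X n)) (toC p))^*)%C *
    (derive1 (transition i (charts X n)) (toC p) : R[i])^-1.
  apply: (@eq_measurable_funC _ _ _ _ f).
    by move=> p; rewrite inE => /AE An; rewrite /extend_form An.
  apply: (measurable_funCS (mO n)); first by move=> p [].
  have md : measurable_funC (O n)
      (fun p => derive1 (transition i (charts X n)) (toC p)).
    apply: measurable_funC_derive1; first exact: overlap_open.
    exact: transition_derivable.
  apply: measurable_funC_mul; last exact: measurable_funC_inv.
  apply: measurable_funC_mul; last exact: measurable_funC_conj.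
  exact: measurable_funC_transition.
rewrite UA; split; apply/measurable_fun_bigcup => // n; first exact: (mf n).1.
exact: (mf n).2.
Qed.

Lemma extend_form_Linfty (s : R) : 0 <= s -> (forall t, normc (g t) <= s) ->
  Linfty (extend_form g : coefficients X).
Proof.
move=> s0 gs; split.
- exact: extend_form_beltrami.
- by move=> i; exact: (measurable_extend_form i).1.
- by move=> i; exact: (measurable_extend_form i).2.
- apply: le_lt_trans (essnorm_le s0 _) _; last exact: ltry.
  by move=> i z _; exact: normc_extend_form.
Qed.

Lemma extend_form_supnorm (s : R) : 0 <= s -> (forall t, normc (g t) <= s) ->
  supnorm (extend_form g : coefficients X) <= s.
Proof.
by move=> s0 gs; apply: supnorm_le => // i z _; exact: normc_extend_form.
Qed.

End extend_form_Linfty.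

(** * Extremal Beltrami forms *)

Section duality.
Context (R : realType) (X : riemannSurface R).
Implicit Types (mu nu phi : coefficients X).
Local Notation normc := Normc.normc.
Local Notation m := (pieces_measure R).
Local Notation M := (on_pieces (0 : Cplx R)).

Local Notation CT :=
  (nat * (measurableTypeR R * measurableTypeR R) -> Rcomplex R).

(** This is the subspace of L^1 from which the pairing functional is extended. *)
Definition A2_image : set CT := M @` A2 (X := X).

Lemma A2_image_subspace : subspace_set A2_image.
Proof.
split.
  exists (@form0 R X); first exact: A2_form0.
  by apply/funext => t; exact: on_pieces_form0.
move=> c _ _ [phi Aphi <-] [psi Apsi <-].
exists (formZD (c%:C)%C phi psi); first exact: A2_formZD.
apply/funext => t; rewrite on_pieces_formZD.
rewrite -[RHS]/(c *: (M phi t : Rcomplex R) + (M psi t : Rcomplex R)).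
congr (_ + _); case: (M phi t) => a b.
by apply/eqP; rewrite eq_complex/= !mul0r subr0 addr0 !eqxx.
Qed.

Lemma Re_mul_linear (c : R) (z : R[i]) (a b : Rcomplex R) :
  complex.Re (z * (c *: a + b)) = c * complex.Re (z * a) + complex.Re (z * b).
Proof. by case: z a b => x y [a1 a2] [b1 b2] /=; ring. Qed.

Lemma pairing_Re mu phi : Linfty mu -> A2 phi ->
  complex.Re (pairing mu phi) = \int[m]_t complex.Re (M mu t * M phi t).
Proof. by move=> Lmu Aphi; rewrite pairingE. Qed.

(* [Im z = Re (- 'i z)], and [A2] is a complex space. *)
Lemma eq_pairing_Re mu nu : Linfty mu -> Linfty nu ->
  (forall phi, A2 phi ->
    complex.Re (pairing mu phi) = complex.Re (pairing nu phi)) ->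
  forall phi, A2 phi -> pairing mu phi = pairing nu phi.
Proof.
move=> Lmu Lnu eqRe phi Aphi.
have := eqRe _ (A2_scale (- 'i)%C Aphi).
rewrite (pairing_scale _ Lmu Aphi) (pairing_scale _ Lnu Aphi).
have := eqRe _ Aphi.
case: (pairing mu phi) (pairing nu phi) => a b [a' b'] /= ->.
rewrite oppr0 !mul0r !sub0r !mulN1r !opprK => ->; done.
Qed.

(* The functional [phi |-> Re (pairing mu phi)] on [A2] has norm at most
   [pairing_norm mu]; its Hahn-Banach extension is represented by [nu]. *)
Lemma exists_minimal_form mu : Linfty mu ->
  exists nu, [/\ Linfty nu, supnorm nu <= pairing_norm mu &
    forall phi, A2 phi -> pairing mu phi = pairing nu phi].
Proof.
move=> Lmu; have s0 := pairing_norm_ge0 Lmu.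
pose l (F : CT) :=
  \int[m]_t complex.Re (M mu t * F t).
have lin : linear_on A2_image l.
  move=> c _ _ [phi Aphi <-] [psi Apsi <-].
  have [iphi _] := L1c_Linfty_mul Lmu (A2_L1c Aphi).
  have [ipsi _] := L1c_Linfty_mul Lmu (A2_L1c Apsi).
  rewrite /l -RintegralZl// -RintegralD//; last exact: (L1Z c iphi).
  by apply: eq_Rintegral => t _; exact: Re_mul_linear.
have WL1 : A2_image `<=` L1c m by move=> _ [phi Aphi <-]; exact: A2_L1c.
have lle (F : CT) :
    A2_image F -> l F <= pairing_norm mu * \int[m]_t normc (F t).
  move=> [phi Aphi <-]; rewrite /l -pairing_Re//.
  apply: le_trans (ler_norm _) _; apply: le_trans (normc_ge_abs_Re _) _.
  exact: normc_pairing_le_mul.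
have [g [mg gs lg]] :=
  functional_extension_dual s0 A2_image_subspace WL1 lin lle.
pose nu : coefficients X := extend_form g.
have Lnu : Linfty nu by exact: (@extend_form_Linfty R X g mg _ s0 gs).
exists nu; split; first exact: Lnu.
  exact: (@extend_form_supnorm R X g _ s0 gs).
(* The extension reproduces real parts only; complex homogeneity of the pairing supplies the
   imaginary parts. *)
apply: (eq_pairing_Re Lmu Lnu) => phi Aphi.
rewrite (pairing_Re Lmu Aphi) (pairing_Re Lnu Aphi).
rewrite -/(l (M phi)) lg; last by exists phi.
apply: eq_Rintegral => -[n p] _; rewrite /on_pieces/=.
case: ifPn => [|_]; last by rewrite !mulr0.
by rewrite inE => np; rewrite /nu extend_form_piece.
Qed.

Lemma pairing_norm_equivalent mu nu :
  (forall phi, A2 phi -> pairing mu phi = pairing nu phi) ->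
  pairing_norm mu = pairing_norm nu.
Proof.
move=> eqp; apply: (congr1 sup); apply: eq_imagel => phi [Aphi _].
exact: congr1 (eqp _ Aphi).
Qed.

Lemma pairing_equivalent mu nu phi : Linfty mu -> Linfty nu ->
  inf_teichmuller_equivalent mu nu -> A2 phi -> pairing mu phi = pairing nu phi.
Proof.
move=> Lmu Lnu [_ N] Aphi; apply/eqP; rewrite -subr_eq0 -pairingB//.
by apply/eqP; exact: N.
Qed.

Lemma teichmuller_extremal_hamilton mu : Linfty mu ->
  inf_teichmuller_extremal mu <-> hamilton mu.
Proof.
move=> Lmu; split=> [ext|ham nu [Lnu N]].
  have [nu [Lnu nus eqp]] := exists_minimal_form Lmu.
  apply/eqP; rewrite eq_le; apply/andP; split.
    exact: (pairing_norm_le Lmu).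
  (* The competitor for extremality is [mu - nu], which lies in [Ninfty]; subtracting it from [mu]
     leaves [nu], whose norm is at most [pairing_norm mu]. *)
  apply: le_trans nus; have -> : nu = mu - (mu - nu).
    apply/funext => i; apply/funext => z.
    by rewrite -[RHS]/(mu i z - (mu i z - nu i z)) subKr.
  apply: ext; split; first exact: LinftyB.
  by move=> phi Aphi; rewrite pairingB// eqp// subrr.
have Ld := LinftyB Lmu Lnu.
rewrite -[leLHS]/(supnorm mu) -(ham : pairing_norm mu = _).
rewrite (@pairing_norm_equivalent _ (mu - nu)); first exact: pairing_norm_le.
by move=> phi Aphi; rewrite pairingB// N// subr0.
Qed.

End duality.

Theorem theorem3p1 (R : realType) (X : riemannSurface R)
    (phi0 : coefficients X) (phi0_A2 : A2 phi0) :
  (forall mu nu : coefficients X, Linfty mu -> Linfty nu ->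
     inf_teichmuller_equivalent mu nu -> beta mu phi0 = beta nu phi0) /\
  (forall mu : coefficients X, Linfty mu ->
     (inf_extremal phi0 mu <-> inf_teichmuller_extremal mu) /\
     (inf_teichmuller_extremal mu <-> hamilton mu)).
Proof.
split=> [mu nu Lmu Lnu eqv|mu Lmu].
  have eqp phi : A2 phi -> pairing mu phi = pairing nu phi.
    exact: pairing_equivalent Lmu Lnu eqv.
  rewrite (beta_pairing_norm Lmu phi0_A2) (beta_pairing_norm Lnu phi0_A2).
  by rewrite (eqp _ phi0_A2) (pairing_norm_equivalent eqp).
have TH := teichmuller_extremal_hamilton Lmu.
split; last exact: TH.
rewrite TH /inf_extremal (beta_pairing_norm Lmu phi0_A2).
split; first exact: addIr.
by rewrite /hamilton -/(pairing_norm mu) => ->.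
Qed.
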